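(* Let $W$ be a holomorphic $d$-web of codimension one on $M$ ($\dim M=n\ge 2$, $d>n$), at least in weak general position, whose foliations are defined on the open set under consideration by first integrals $u_1,\dots,u_d$ without singularity, and use local coordinates $(x_1,\dots,x_n)$. Then: (i) For every $k\ge 0$, locally $R_k$ is the kernel of the matrix $\mathcal M_{k+1}$ (included in the trivial bundle $\Theta^{(k+1)d}$ of rank $(k+1)d$): for every point $m$, the injective linear map $\Phi_{k,m}:\mathbb C^{(k+1)d}\to\bigoplus_{i=1}^d J^k_mA_i$ defined in the context satisfies $\Phi_{k,m}(\ker \mathcal M_{k+1}(m))=R_{k,m}$. Hence, when the matrix $\mathcal M_{k+1}$ has constant rank (which is always the case for $k\le h_0-2$ if $W$ is ordinary), $R_k\to M$ is a holomorphic vector bundle of rank $$\rho_k=(k+1)d-\operatorname{rank}(\mathcal M_{k+1}).$$ (ii) Let $k\ge 1$. If an element $a_{k-1}\in R_{k-1}$ (seen in $\Theta^{kd}$) over a point $m$ is given by the family $f=(f^{(h)})_{0\le h\le k-1}$ of vectors $f^{(h)}\in\mathbb C^d$, then the elements of $R_k$ which project onto $a_{k-1}$ are those $(f^{(0)},\dots,f^{(k-1)},f^{(k)})$ whose last component $f^{(k)}\in\mathbb C^d$ is a solution of the linear system $$P_{k+1}\,f^{(k)}=-Q_{k+1}\,f=-\sum_{h=0}^{k-1}M_{k+1}^{(h)}\,f^{(h)},$$ all matrices being evaluated at $m$.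
   Context: **Webs.** A (totally decomposable) holomorphic $d$-web $W$ of codimension one, without singularity, on a complex $n$-dimensional manifold $M$ is the data of $d$ holomorphic regular foliations $\mathcal F_1,\dots,\mathcal F_d$ of codimension one on $M$, any two of them being transverse to each other at every point. It is in weak general position if at every point there are at least $n$ of the $d$ foliations whose tangent spaces there are in general position. Locally $\mathcal F_i$ is defined by a first integral $u_i$ with $du_i$ nowhere zero. **Formal abelian relations.** $A_i\subset T^*M$ is the line bundle of 1-forms vanishing on $T\mathcal F_i$ (locally spanned by $du_i$). $A$ is the kernel of $Tr:\bigoplus_{i=1}^d A_i\to T^*M$, $(\omega_i)_i\mapsto\sum_i\omega_i$, a holomorphic vector bundle of rank $d-n$. Let $B=(\wedge^2T^*M)^{\oplus d}$ and let $D$ be the first order differential operator $(\omega_i)_i\mapsto(d\omega_i)_i$ from sections of $A$ to sections of $B$. For $k\ge1$, $D_k:J^kA\to J^{k-1}B$ is the prolongation $j^ks\mapsto j^{k-1}(Ds)$, and $R_k=\ker D_k\subset J^kA\subset\bigoplus_iJ^kA_i$ is the space of formal abelian relations of order $k$; $R_0=A$. $R_{k,m}$ is the fibre over $m$. The projection $\pi_k:R_k\to R_{k-1}$ is truncation of jets. **Identification.** $\Phi_{k,m}$ sends $(w_i^{(h)})_{0\le h\le k,\,1\le i\le d}$ to the family of $k$-jets at $m$ of the 1-forms $g_i(u_i)\,du_i$, where $g_i$ is any holomorphic function of one variable near $u_i(m)$ whose $h$-th derivative satisfies $g_i^{(h)}(u_i(m))=w_i^{(h)}$ for $0\le h\le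 k$. Via $\Phi_{k,m}$, elements of $R_{k,m}$ are written as families $(f^{(0)},\dots,f^{(k)})$ of vectors $f^{(h)}=(f^{(h)}_1,\dots,f^{(h)}_d)\in\mathbb C^d$. **Matrices.** For a multi-index $L=(\ell_1,\dots,\ell_n)$, $|L|=\sum\ell_\lambda$; $1_\lambda$ has 1 at place $\lambda$ and 0 elsewhere; $\partial_\lambda=\partial/\partial x_\lambda$. For a holomorphic function $u$, the coefficients $C^h_L(u)$ ($|L|\ge1$, $0\le h\le|L|-1$) are defined inductively by $C^0_{1_\lambda}(u)=\partial_\lambda u$; $C^0_{L+1_\mu}(u)=\partial_\mu C^0_L(u)$; $C^h_{L+1_\mu}(u)=\partial_\mu C^h_L(u)+C^{h-1}_L(u)\,\partial_\mu u$ for $1\le h\le|L|-1$; $C^{|L|}_{L+1_\mu}(u)=C^{|L|-1}_L(u)\,\partial_\mu u$. (They are well defined, and are the coefficients for which $\partial_L\big((g\circ u)\,\partial_\lambda u\big)=\sum_{h=0}^{|L|}C^h_{L+1_\lambda}(u)\,(g^{(h)}\circ u)$ for every holomorphic $g$.) Put $C^h_{i,L}=C^h_L(u_i)$. With $c(n,h)=\frac{(n-1+h)!}{(n-1)!\,h!}$: - $M_j^{(h)}$ ($j\ge1$, $h\ge0$) is the $c(n,j)\times d$ matrix with entries $C^h_{i,L}$, rows indexed by $L$ with $|L|=j$, columns by $i$; $M_j^{(h)}=0$ for $h\ge j$. - $P_j=M_j^{(j-1)}$, whose entries are $\prod_\lambda(\partial_\lambda u_i)^{\ell_\lambda}$,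 $|L|=j$. - $\mathcal M_k$ is the block matrix of size $\big(\sum_{j=1}^kc(n,j)\big)\times kd$ with block $M_j^{(h)}$ in block-row $j$ ($1\le j\le k$) and block-column $h$ ($0\le h\le k-1$). - $Q_{k+1}=\big(M_{k+1}^{(0)}\ M_{k+1}^{(1)}\cdots M_{k+1}^{(k-1)}\big)$, of size $c(n,k+1)\times kd$. **Ordinary webs.** $h_0$ is the integer with $c(n,h_0-1)<d\le c(n,h_0)$. $W$ is ordinary if for every $j\ge 1$ the matrix $P_j$ has maximal rank $\inf(d,c(n,j))$ at every point. *)

(* Defs.v *)
From HB Require Import structures.
From mathcomp Require Import all_boot all_order all_algebra.
From mathcomp Require Import all_classical all_reals all_analysis.

Set Implicit Arguments.
Unset Strict Implicit.
Unset Printing Implicit Defensive.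

Import Order.TTheory GRing.Theory Num.Theory.
Import numFieldNormedType.Exports.

Local Open Scope classical_set_scope.
Local Open Scope ring_scope.

(* The definitions are stated over an arbitrary numFieldType [K] and are used
   with the complex numbers [K := R[i]], [R : realType].  The norm topology of
   [K] and the derivatives below are those over [K], so that, for [K = R[i]],
   [differentiable] means complex (Frechet) differentiable, and [holo_on] is
   holomorphy on an open set.  Points and tangent vectors of an open subset of
   C^n are row vectors; a 1-form is the row of its coefficients in
   dx_1, ..., dx_n. *)

Definition holo_on (K : numFieldType) (V W : normedModType K)
  (N : set V) (f : V -> W) : Prop := forall x, N x -> differentiable f x.

(* [midx n j] is the set of the L with |L| = j and [midx_le n k] that of the L
   with |L| <= k; the bound on the individual entries is automatic. *)
Definition midx (n j : nat) : finType :=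
  {L : {ffun 'I_n -> 'I_j.+1} | (\sum_l L l == j)%N}.

Definition midx_le (n k : nat) : finType :=
  {L : {ffun 'I_n -> 'I_k.+1} | (\sum_l L l <= k)%N}.

(* A multi-index as the sorted word containing each index l exactly L_l times. *)
Definition mword (n : nat) (L : 'I_n -> nat) : seq 'I_n :=
  flatten [seq nseq (L l) l | l <- enum 'I_n].

Definition midx_word (n j : nat) (L : midx n j) : seq 'I_n :=
  mword (fun l => val L l).

Definition midx_le_word (n k : nat) (L : midx_le n k) : seq 'I_n :=
  mword (fun l => val L l).

(* c(n,h) = (n-1+h)! / ((n-1)! h!) *)
Definition cnum (n h : nat) : nat := 'C(n - 1 + h, h).

Lemma card_midx (n j : nat) : (0 < n)%N -> #|midx n j| = cnum n j.
Proof.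
case: n => // n _; rewrite /cnum subn1 /=.
have -> : 'C(n + j, j) = 'C(j + n, n).
  by rewrite -[in RHS]bin_sub ?leq_addl // addnK addnC.
rewrite addnC -[in RHS]card_ord_partitions card_sub.
rewrite -(card_imset _ (can_inj (@tuple_of_finfunK _ _))).
apply: eq_card => t; rewrite [in RHS]inE; apply/imsetP/idP => [[L]|Ht].
  rewrite inE => HL ->; rewrite big_tuple; apply/eqP; rewrite -[RHS](eqP HL).
  by apply: eq_bigr => l _; rewrite tnth_mktuple.
exists (finfun_of_tuple t); last by rewrite finfun_of_tupleK.
rewrite big_tuple in Ht; rewrite inE; apply/eqP; rewrite -[RHS](eqP Ht).
by apply: eq_bigr => l _; rewrite ffunE.
Qed.

Lemma midx_le_widen_proof (n k : nat) (L : midx_le n k) :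
  (\sum_l [ffun l => widen_ord (leqnSn k.+1) (val L l)] l <= k.+1)%N.
Proof.
apply: leq_trans (leqnSn k); apply: leq_trans (valP L).
by apply: leq_sum => l _; rewrite ffunE.
Qed.

Definition midx_le_widen (n k : nat) (L : midx_le n k) : midx_le n k.+1 :=
  exist (fun L' : {ffun 'I_n -> 'I_k.+2} => (\sum_l L' l <= k.+1)%N) _
    (midx_le_widen_proof L).

Section Web.
Variables (K : numFieldType) (n : nat).
Local Notation V := 'rV[K]_n.

Definition pd (l : 'I_n) (f : V -> K) : V -> K :=
  fun x => 'D_(delta_mx 0 l) f x.

Definition pd_word (s : seq 'I_n) (f : V -> K) : V -> K := foldr pd f s.

Definition dform (f : V -> K) (x : V) : V := \row_l pd l f x.

(* The k-jet at m of a family of functions indexed by I is the family of the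
   values at m of their partial derivatives of order at most k. *)
Definition jets (I : finType) (k : nat) := {ffun I * midx_le n k -> K^o}.

Definition jet (I : finType) (k : nat) (m : V) (f : I -> V -> K) : jets I k :=
  [ffun t => pd_word (midx_le_word t.2) (f t.1) m].

Definition jet_trunc (I : finType) (k : nat) (J : jets I k.+1) : jets I k :=
  [ffun t => J (t.1, midx_le_widen t.2)].

(* A family (E_x), x in U, of subsets of a fixed space of jets is a holomorphic
   vector (sub)bundle of rank r over U: around each point of U there is a
   holomorphic frame. *)
Definition holo_vector_bundle (I : finType) (k : nat) (U : set V)
    (E : V -> set (jets I k)) (r : nat) : Prop :=
  forall m, U m -> exists2 N : set V, open_nbhs m N /\ N `<=` U &
    exists e : 'I_r -> V -> jets I k,
      (forall j t, holo_on N (fun x => e j x t : K)) /\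
      (forall x, N x ->
        E x = [set \sum_j a j *: e j x | a in [set: 'I_r -> K]] /\
        (forall a : 'I_r -> K, \sum_j a j *: e j x = 0 -> forall j, a j = 0)).

Variable d : nat.
Implicit Types (U : set V) (u : 'I_d -> V -> K) (k : nat) (m x : V).

(* Tangent space of the foliation u = constant: the row space of this matrix
   is the set of vectors v such that du(x)(v) = 0. *)
Definition tgt (f : V -> K) (x : V) : 'M[K]_n := kermx (dform f x)^T.

(* The foliations u_i = constant, i < d, form a d-web of codimension one on U
   with first integrals u_i. *)
Definition is_web U u : Prop :=
  [/\ open U,
      forall i, holo_on U (u i),
      forall i x, U x -> dform (u i) x != 0 &
      forall i j x, U x -> i != j ->
        row_full (tgt (u i) x + tgt (u j) x)%MS].

(* The tangent spaces of the foliations in S are in general position at x: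
   any r <= n of them intersect in codimension r. *)
Definition general_position u x (S : {set 'I_d}) : Prop :=
  forall T : {set 'I_d}, T \subset S -> (#|T| <= n)%N ->
    (\rank (\bigcap_(i in T) tgt (u i) x)%MS + #|T| = n)%N.

Definition weak_general_position U u : Prop :=
  forall x, U x ->
    exists2 S : {set 'I_d}, (n <= #|S|)%N & general_position u x S.

Definition comp1 (s : 'I_d -> V -> V) (t : 'I_d * 'I_n) : V -> K :=
  fun x => s t.1 x 0 t.2.

(* The components of the family of the 2-forms ds_i. *)
Definition Dop (s : 'I_d -> V -> V) (t : 'I_d * ('I_n * 'I_n)) : V -> K :=
  fun x => pd t.2.1 (comp1 s (t.1, t.2.2)) x
         - pd t.2.2 (comp1 s (t.1, t.2.1)) x.

(* w belongs to the fibre at x of the line bundle A_i attached to f = u_i. *)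
Definition in_Ai (f : V -> K) (x : V) (w : V) : Prop := tgt f x *m w^T = 0.

(* Germs at m of holomorphic sections of the direct sum of the A_i, and of
   A = ker Tr. *)
Definition germ_sumAi u m (s : 'I_d -> V -> V) : Prop :=
  \forall x \near m, forall i, differentiable (s i) x /\ in_Ai (u i) x (s i x).

Definition germ_A u m (s : 'I_d -> V -> V) : Prop :=
  germ_sumAi u m s /\ \forall x \near m, \sum_i s i x = 0.

Definition J_sumAi u k m : set (jets ('I_d * 'I_n)%type k) :=
  [set jet k m (comp1 s) | s in germ_sumAi u m].

(* R_{k,m}, the kernel of j^k s |-> j^(k-1) (D s).  For k = 0 there is no
   condition, and R_0 consists of the values at m of the sections of A. *)
Definition formal_AR u k m : set (jets ('I_d * 'I_n)%type k) :=
  [set jet k m (comp1 s) | s in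
    [set s | germ_A u m s /\
             (if k is k'.+1 then jet k' m (Dop s) = 0 else True)]].

(* The family of 1-forms g_i(u_i) du_i. *)
Definition pullback_forms u (g : 'I_d -> K -> K) : 'I_d -> V -> V :=
  fun i x => g i (u i x) *: dform (u i) x.

(* Each g_i is holomorphic near u_i(m), with h-th derivative w_i^(h) at u_i(m)
   for 0 <= h <= k.  Elements w of C^{(k+1)d} are column vectors made of k+1
   blocks w^(h) of size d. *)
Definition has_derivatives u k m (w : 'cV[K]_(\sum_(h < k.+1) d))
    (g : 'I_d -> K -> K) : Prop :=
  forall i : 'I_d,
    (\forall z \near u i m, differentiable (g i) z) /\
    (forall h : 'I_k.+1, derive1n h (g i) (u i m) = submxcol w h i 0).

(* A particular choice of such g_i, used to define Phi. *)
Definition taylor_poly u k m (w : 'cV[K]_(\sum_(h < k.+1) d)) (i : 'I_d) : K -> K :=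
  fun z => \sum_(h < k.+1)
    submxcol w h i 0 / (h`!)%:R * (z - u i m) ^+ h.

Definition Phi u k m (w : 'cV[K]_(\sum_(h < k.+1) d)) : jets ('I_d * 'I_n)%type k :=
  jet k m (comp1 (pullback_forms u (taylor_poly u m w))).

(* C^h_L(f), where L is given by the word of its indices, the last index mu
   added being the head of the word; C^h_L is 0 when L = 0 or h >= |L|. *)
Fixpoint coefC (f : V -> K) (s : seq 'I_n) (h : nat) : V -> K :=
  match s with
  | [::] => fun=> 0
  | [:: l] => if h == 0%N then pd l f else fun=> 0
  | mu :: s' => fun x =>
      if h == 0%N then pd mu (coefC f s' 0) x
      else if (h < size s')%N then
        pd mu (coefC f s' h) x + coefC f s' h.-1 x * pd mu f x
      else if h == size s' then coefC f s' h.-1 x * pd mu f x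
      else 0
  end.

Definition Mblock u (j h : nat) x : 'M[K]_(#|midx n j|, d) :=
  \matrix_(r, i) coefC (u i) (midx_word (enum_val r)) h x.

Definition Pmx u (j : nat) x : 'M[K]_(#|midx n j|, d) := Mblock u j j.-1 x.

Definition Mbig u k x :
    'M[K]_(\sum_(j < k) #|midx n j.+1|, \sum_(h < k) d) :=
  \mxblock_(j < k, h < k) Mblock u j.+1 h x.

(* Q_{k+1} *)
Definition Qmx u k x : 'M[K]_(#|midx n k.+1|, \sum_(h < k) d) :=
  \mxrow_(h < k) Mblock u k.+1 h x.

Definition ordinary U u : Prop :=
  forall j x, (0 < j)%N -> U x -> \rank (Pmx u j x) = minn d (cnum n j).

(* The family (f^(0), ..., f^(k-1), g). *)
Definition fam_rcons k (f : 'I_k -> 'cV[K]_d) (g : 'cV[K]_d) :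
    'I_k.+1 -> 'cV[K]_d :=
  fun h => if unlift ord_max h is Some h' then f h' else g.

End Web.

Arguments J_sumAi {K n d}.
Arguments formal_AR {K n d}.
Arguments Phi {K n d} u {k} m w.

(* Main.v *)
Require Import Defs.
From HB Require Import structures.
From mathcomp Require Import all_boot all_order all_algebra.
From mathcomp Require Import complex.
From mathcomp Require Import all_classical all_reals all_analysis.
From mathcomp Require Import ring lra.
Set Implicit Arguments.
Unset Strict Implicit.
Unset Printing Implicit Defensive.
Import Order.TTheory GRing.Theory Num.Theory.
Import numFieldNormedType.Exports.
Local Open Scope classical_set_scope.
Local Open Scope ring_scope.

(** Up to the regularity of holomorphic functions, the theorem is a computation
   with jets. By the chain and product rules, the partial derivatives of the
   components of g(u) du are the sums over h of C^h_L(u) g^(h)(u)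
   [pd_word_pullback]; for polynomials g this shows that C^h_L(u) is the L-th
   partial derivative at x of (u - u(x))^(h+1) / (h+1)!, and so does not depend
   on the order of the indices in L [coefC_pd, coefC_perm]. Hence the jets of
   the forms g_i(u_i) du_i are linear functions of the derivatives w of the g_i,
   they determine w, since the derivatives in a direction where du_i is not 0
   form a triangular system with nonzero diagonal [pull_jet0], and the sum of
   these forms vanishes to order k if and only if w is in the kernel of the
   matrix M_(k+1) [Mbig_pull_jet].

   A section of A is a family of forms a_i du_i with sum 0. If the
   differentials da_i /\ du_i vanish to order k - 1 at m, then each a_i agrees
   to order k with a function of u_i [wedge_van], so that the k-jet of the
   section is in the image of the kernel [formal_AR_sub]. Conversely, forms
   g_i(u_i) du_i whose sum vanishes to order k are made into a section of A by
   subtracting from n of them, independent at m by weak general position, the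
   components of the sum; this changes neither the k-jets nor the vanishing
   (k-1)-jets of the differentials [formal_AR_sup]. The rest is linear algebra:
   the kernel of a matrix of constant rank has holomorphic frames
   [kernel_frame]; the matrix M_(k+1) is block triangular with diagonal blocks
   P_j, hence of full row rank when these are [Mbig_row_free]; and its last
   block row is the system of the second part [Mbig_fam_rcons].

   All of this uses that holomorphic functions, which are only assumed to be
   complex differentiable, have holomorphic and commuting partial derivatives.
   Bisection gives Goursat's theorem on rectangles [goursat]. In the exponential
   coordinate of a punctured disk it says that circle means do not depend on the
   radius [circle_mean], whence Cauchy's formula for the derivative at the
   centre of a circle [circle_derive], here on complex lines of an arbitrary
   normed space [circle_diff]. The formula makes the differential of f locally
   Lipschitz, so the remainder of f at first order is uniformly quadratic
   [diff_quad]; inserting this estimate in the formula shows that directional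
   derivatives are differentiable, with iterated derivatives given by a circle
   integral that is symmetric in the two directions [holo_derive,
   holo_derive_comm]. *)

(** * Real-valued norms over the complex numbers *)

(** R[i] as a normed space over itself. *)
HB.instance Definition _ (R : realType) :=
  NormedModule.copy R[i] (R[i] : numFieldType)^o.

Section RealNorm.
Context {R : realType}.
Local Notation C := R[i].

(** Norms over R[i] take values in R[i], which is only partially ordered; this is
   the same norm with values in R. *)
Definition nrm (V : normedModType C) (v : V) : R := complex.Re `|v|.

Lemma nrmE (V : normedModType C) (v : V) : `|v| = (nrm v)%:C%C.
Proof. by rewrite /nrm RRe_real// normr_real. Qed.

Lemma nrm_le (V : normedModType C) (v : V) (e : R) :
  (`|v| <= e%:C%C) = (nrm v <= e).
Proof. by rewrite nrmE lecR. Qed.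

Lemma nrm_lt (V : normedModType C) (v : V) (e : R) :
  (`|v| < e%:C%C) = (nrm v < e).
Proof. by rewrite nrmE ltcR. Qed.

Lemma nrm_ge0 (V : normedModType C) (v : V) : 0 <= nrm v.
Proof. by rewrite -lecR -nrmE normr_ge0. Qed.

Lemma nrm0 (V : normedModType C) : nrm (0 : V) = 0.
Proof. by rewrite /nrm normr0. Qed.

Lemma nrm_eq0 (V : normedModType C) (v : V) : (nrm v == 0) = (v == 0).
Proof. by rewrite -[v == 0]normr_eq0 nrmE -(inj_eq (@complexI R)). Qed.

Lemma nrm_gt0 (V : normedModType C) (v : V) : (0 < nrm v) = (v != 0).
Proof. by rewrite lt_def nrm_ge0 andbT nrm_eq0. Qed.

Lemma nrmD (V : normedModType C) (v w : V) : nrm (v + w) <= nrm v + nrm w.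
Proof. by rewrite -nrm_le rmorphD/= -!nrmE ler_normD. Qed.

Lemma nrmN (V : normedModType C) (v : V) : nrm (- v) = nrm v.
Proof. by rewrite /nrm normrN. Qed.

Lemma nrmB (V : normedModType C) (v w : V) : nrm (v - w) <= nrm v + nrm w.
Proof. by rewrite -(nrmN w) nrmD. Qed.

Lemma nrmBC (V : normedModType C) (v w : V) : nrm (v - w) = nrm (w - v).
Proof. by rewrite -nrmN opprB. Qed.

Lemma nrmZ (V : normedModType C) (a : C) (v : V) : nrm (a *: v) = nrm a * nrm v.
Proof. by apply: (@complexI R); rewrite rmorphM/= -!nrmE normrZ. Qed.

Lemma nrmM (a b : C) : nrm (a * b) = nrm a * nrm b.
Proof. by rewrite -nrmZ. Qed.

Lemma nrmV (a : C) : nrm a^-1 = (nrm a)^-1.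
Proof. by apply: (@complexI R); rewrite fmorphV/= -!nrmE normfV. Qed.

Lemma nrmR (r : R) : nrm (r%:C%C : C) = `|r|.
Proof.
apply: (@complexI R); rewrite -nrmE normc_def/=; congr (_%:C%C).
by rewrite expr0n /= addr0 sqrtr_sqr.
Qed.

Lemma nrm_i : nrm ('i%C : C) = 1.
Proof.
by rewrite /nrm normc_def/= expr0n /= add0r expr1n sqrtr1.
Qed.

Lemma Re_le_nrm (z : C) : `|complex.Re z| <= nrm z.
Proof. by rewrite -lecR -nrmE normc_ge_Re. Qed.

Lemma Im_le_nrm (z : C) : `|complex.Im z| <= nrm z.
Proof.
have := Re_le_nrm (z * 'i%C); rewrite ReiNIm normrN nrmM nrm_i mulr1.
by [].
Qed.

Lemma nrm_le_ReIm (z : C) : nrm z <= `|complex.Re z| + `|complex.Im z|.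
Proof.
rewrite {1}[z]complexE (le_trans (nrmD _ _))// nrmM nrm_i mul1r.
by rewrite !nrmR.
Qed.

End RealNorm.

(** * Integration of complex functions of a real variable *)

Section RealVariable.
Context {R : realType}.
Local Notation C := R[i].
Local Notation mu := (@lebesgue_measure R).

Local Notation Re := (@complex.Re R).
Local Notation Im := (@complex.Im R).

Lemma ReD (z w : C) : Re (z + w) = Re z + Re w.
Proof. by case: z; case: w. Qed.

Lemma ImD (z w : C) : Im (z + w) = Im z + Im w.
Proof. by case: z; case: w. Qed.

Lemma ReB (z w : C) : Re (z - w) = Re z - Re w.
Proof. by case: z; case: w. Qed.

Lemma ImB (z w : C) : Im (z - w) = Im z - Im w.
Proof. by case: z; case: w. Qed.

Lemma ReM (z w : C) : Re (z * w) = Re z * Re w - Im z * Im w.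
Proof. by case: z; case: w. Qed.

Lemma ImM (z w : C) : Im (z * w) = Re z * Im w + Im z * Re w.
Proof. by case: z; case: w. Qed.

Lemma continuous_prim (f : R -> R) (a : R) : continuous f ->
  exists F : R -> R, forall t, a < t -> is_derive t 1 F (f t).
Proof.
move=> cf; exists (fun x => \int[mu]_(t in [set` `[a, x]]) f t)%R => t at_.
have fi : mu.-integrable `[a, t + 1] (EFin \o f).
  apply: continuous_compact_integrable; first exact: segment_compact.
  exact: continuous_subspaceT.
have tt1 : t < t + 1 by rewrite ltrDl.
have ct := cf t.
have h1 := @continuous_FTC1_closed R f a t (t + 1) tt1.
have h2 := h1 fi.
have h3 := h2 at_ ct.
case: h3 => dF F'.
split; first exact: dF.
by rewrite -derive1E F'.
Qed.

(** Composition with this retraction onto [a, b] extends a function continuous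
   on [a, b] to a continuous function on the line. *)
Definition clamp (a b t : R) : R := Num.max a (Num.min b t).

Lemma clamp_itv (a b t : R) : a <= b -> a <= clamp a b t <= b.
Proof.
by move=> ab; rewrite /clamp le_max lexx/= ge_max ab ge_min lexx.
Qed.

Lemma clamp_id (a b t : R) : a <= t <= b -> clamp a b t = t.
Proof.
by move=> /andP[at_ tb]; rewrite /clamp (min_r tb) (max_r at_).
Qed.

Lemma clamp_dist (a b s t : R) : `|clamp a b s - clamp a b t| <= `|s - t|.
Proof.
have h x y : `|Num.max a x - Num.max a y| <= `|x - y|.
  have := ler_norm (x - y); have := ler_norm (y - x); rewrite (distrC y) => ? ?.
  by case: (leP a x) => ?; case: (leP a y) => ?; rewrite ler_norml; apply/andP; split; lra.
apply: le_trans (h _ _) _.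
have := ler_norm (s - t); have := ler_norm (t - s); rewrite (distrC t) => ? ?.
by case: (leP b s) => ?; case: (leP b t) => ?; rewrite ler_norml; apply/andP; split; lra.
Qed.

Definition ccont (a b : R) (p : R -> C) := forall t, a <= t <= b ->
  forall e, 0 < e -> exists2 dl, 0 < dl &
    forall s, a <= s <= b -> `|s - t| < dl -> nrm (p s - p t) < e.

Definition cderiv (F : R -> C) (t : R) (v : C) :=
  is_derive t 1 (Re \o F) (Re v) /\
  is_derive t 1 (Im \o F) (Im v).

Lemma ccont_prim (a b : R) p : a <= b -> ccont a b p ->
  exists F, forall t, a <= t <= b -> cderiv F t (p t).
Proof.
move=> ab pc.
have key (f : C -> R) : (forall z w, `|f z - f w| <= nrm (z - w)) ->
    continuous (fun t => f (p (clamp a b t))).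
  move=> fl t; apply/cvgrPdist_lt => e e0.
  have [dl dl0 h] := pc _ (clamp_itv t ab) _ e0.
  exists dl => //= s; rewrite /ball/= => st; rewrite distrC.
  apply: le_lt_trans (fl _ _) _; apply: h; first exact: clamp_itv.
  by apply: le_lt_trans (clamp_dist _ _ _ _) _; rewrite distrC.
have /(@continuous_prim _ (a - 1)) [F1 h1] : continuous (fun t => Re (p (clamp a b t))).
  by apply: key => z w; rewrite -ReB Re_le_nrm.
have /(@continuous_prim _ (a - 1)) [F2 h2] : continuous (fun t => Im (p (clamp a b t))).
  by apply: key => z w; rewrite -ImB Im_le_nrm.
exists (fun t => Complex (F1 t) (F2 t)) => t tab.
have a1 : a - 1 < t by lra.
by split; [have := h1 _ a1|have := h2 _ a1]; rewrite clamp_id.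
Qed.

Lemma cderivD F G t v w : cderiv F t v -> cderiv G t w ->
  cderiv (fun s => F s + G s) t (v + w).
Proof.
move=> [F1 F2] [G1 G2]; split; rewrite /comp.
  rewrite (_ : (fun _ => _) = (Re \o F) + (Re \o G)).
    by rewrite ReD; exact: is_deriveD.
  by apply/funext => s /=; rewrite ReD.
rewrite (_ : (fun _ => _) = (Im \o F) + (Im \o G)).
  by rewrite ImD; exact: is_deriveD.
by apply/funext => s /=; rewrite ImD.
Qed.

Lemma cderivZ k F t v : cderiv F t v -> cderiv (fun s => k * F s) t (k * v).
Proof.
move=> [F1 F2].
split; rewrite /comp.
  rewrite (_ : (fun _ => _) = (Re k *: (Re \o F)) - (Im k *: (Im \o F))).
    by rewrite ReM; apply: is_deriveB; exact: is_deriveZ.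
  by apply/funext => s /=; rewrite ReM.
rewrite (_ : (fun _ => _) = (Re k *: (Im \o F)) + (Im k *: (Re \o F))).
  by rewrite ImM; apply: is_deriveD; exact: is_deriveZ.
by apply/funext => s /=; rewrite ImM.
Qed.

Lemma real_mvi (F f : R -> R) (a b M : R) : a <= b ->
  (forall t, a <= t <= b -> is_derive t 1 F (f t)) ->
  (forall t, a <= t <= b -> `|f t| <= M) -> `|F b - F a| <= M * (b - a).
Proof.
rewrite le_eqVlt => /predU1P[->|ab] dF fM; first by rewrite !subrr normr0 mulr0.
have [c|cF|c cab ->] := @MVT R F f a b ab.
- by rewrite in_itv/= => /andP[? ?]; apply: dF; rewrite !ltW.
- by apply: derivable_within_continuous => c; rewrite in_itv/= => h; case: (dF c h).
- have ba : 0 < b - a by rewrite subr_gt0.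
  rewrite normrM (gtr0_norm ba); apply: ler_wpM2r; first exact: ltW.
  by apply: fM; move: cab; rewrite in_itv/= => /andP[? ?]; rewrite !ltW.
Qed.

(** The factor 2 comes from treating the real and imaginary parts separately. *)
Lemma cderiv_mvi F f (a b M : R) : a <= b ->
  (forall t, a <= t <= b -> cderiv F t (f t)) ->
  (forall t, a <= t <= b -> nrm (f t) <= M) -> nrm (F b - F a) <= 2 * M * (b - a).
Proof.
move=> ab dF fM; apply: le_trans (nrm_le_ReIm _) _.
rewrite ReB ImB.
have := @real_mvi (Re \o F) (Re \o f) a b M ab.
move=> /(_ (fun t h => (dF t h).1) (fun t h => le_trans (Re_le_nrm _) (fM t h))) /=.
have := @real_mvi (Im \o F) (Im \o f) a b M ab.
move=> /(_ (fun t h => (dF t h).2) (fun t h => le_trans (Im_le_nrm _) (fM t h))) /=.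
lra.
Qed.

(** The integral as the increment of a primitive: this makes additivity,
   linearity and bounds consequences of the rules for derivatives. *)
Definition cint (a b : R) (p : R -> C) : C :=
  get [set v | exists2 F, (forall t, a <= t <= b -> cderiv F t (p t)) & v = F b - F a].

Lemma cintE F (a b : R) p : a <= b -> (forall t, a <= t <= b -> cderiv F t (p t)) ->
  cint a b p = F b - F a.
Proof.
move=> ab dF; rewrite /cint; case: xgetP => [_ -> [G dG ->]|/(_ (F b - F a))[]]; last by exists F.
apply/eqP; rewrite -subr_eq0 -nrm_eq0 eq_le nrm_ge0 andbT.
have := @cderiv_mvi (fun t => G t + (-1) * F t) (fun=> 0) a b 0 ab.
rewrite mulr0 mul0r.
rewrite (_ : _ - _ = G b - G a - (F b - F a)); last by ring.
apply=> [t h|t h]; last by rewrite nrm0.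
by have := cderivD (dG t h) (cderivZ (-1) (dF t h)); rewrite mulN1r subrr.
Qed.

Lemma cint_exists (a b : R) p : a <= b -> ccont a b p ->
  exists2 F, (forall t, a <= t <= b -> cderiv F t (p t)) & cint a b p = F b - F a.
Proof. by move=> ab /(ccont_prim ab)[F dF]; exists F => //; exact: cintE. Qed.

Lemma cintD (a b : R) p q : a <= b -> ccont a b p -> ccont a b q ->
  cint a b (fun t => p t + q t) = cint a b p + cint a b q.
Proof.
move=> ab /(cint_exists ab)[F dF ->] /(cint_exists ab)[G dG ->].
rewrite (@cintE (fun t => F t + G t))//; first by ring.
by move=> t h; apply: cderivD; [exact: dF|exact: dG].
Qed.

Lemma cintZ (a b : R) k p : a <= b -> ccont a b p ->
  cint a b (fun t => k * p t) = k * cint a b p.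
Proof.
move=> ab /(cint_exists ab)[F dF ->].
rewrite (@cintE (fun t => k * F t))//; first by ring.
by move=> t h; apply: cderivZ; exact: dF.
Qed.

Lemma cint_le (a b : R) p M : a <= b -> ccont a b p ->
  (forall t, a <= t <= b -> nrm (p t) <= M) -> nrm (cint a b p) <= 2 * M * (b - a).
Proof. by move=> ab /(cint_exists ab)[F dF ->]; exact: cderiv_mvi. Qed.

Lemma cint_eq (a b : R) p q : (forall t, a <= t <= b -> p t = q t) ->
  cint a b p = cint a b q.
Proof.
move=> pq; rewrite /cint; congr get; apply/seteqP; split => v [F dF ->].
  by exists F => // t h; rewrite -pq//; exact: dF.
by exists F => // t h; rewrite pq//; exact: dF.
Qed.

Lemma cint_split (a b c : R) p : a <= b <= c -> ccont a c p ->
  cint a c p = cint a b p + cint b c p.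
Proof.
move=> /andP[ab bc] /(cint_exists (le_trans ab bc))[F dF ->].
rewrite (@cintE F a b)// 1?(@cintE F b c)//; first by ring.
  by move=> t ?; apply: dF; lra.
by move=> t ?; apply: dF; lra.
Qed.

Lemma cderiv_affine (k l : C) t : cderiv (fun s => k + s%:C%C * l) t l.
Proof.
have -> : (fun s : R => k + s%:C%C * l) =
   fun s => Complex (Re k + s * Re l) (Im k + s * Im l).
  apply/funext => s; case: k => k1 k2; case: l => l1 l2; apply/eqP; rewrite eq_complex /=.
  by rewrite !mul0r subr0 addr0 !eqxx.
by split; rewrite /comp /=; apply: is_derive_eq; rewrite /GRing.scale/=; ring.
Qed.

End RealVariable.

(** * Goursat's theorem on rectangles *)

Section ComplexDifferential.
Context {R : realType}.
Local Notation C := R[i].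

Lemma near_nrmP (V : normedModType C) (x : V) (P : set V) :
  (\forall y \near x, P y) <->
  exists2 dl : R, 0 < dl & forall y, nrm (y - x) < dl -> P y.
Proof.
split=> [/nbhs_normP[/= e e0 h]|[dl dl0 h]].
  have eE : (complex.Re e)%:C%C = e by rewrite RRe_real// gtr0_real.
  exists (complex.Re e); first by rewrite -ltcR eE.
  by move=> y yx; apply: h; rewrite /ball_/= distrC -eE nrm_lt.
apply/nbhs_normP; exists dl%:C%C; first by rewrite /= ltcR.
by move=> y; rewrite /ball_/= distrC nrm_lt; exact: h.
Qed.

Lemma diff_nrm (V W : normedModType C) (f : V -> W) (x : V) :
  differentiable f x -> forall e : R, 0 < e -> exists2 dl : R, 0 < dl &
    forall y, nrm (y - x) < dl ->
      nrm (f y - f x - 'd f x (y - x)) <= e * nrm (y - x).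
Proof.
move=> /diff_locally/eqaddoP h e e0.
have /near_nrmP[dl dl0 {}h] := h e%:C%C ltac:(by rewrite ltcR).
exists dl => // y yx; have := h (y - x); rewrite subr0 => /(_ yx) /=.
rewrite -lecR rmorphM/= -!nrmE /= => H; apply: le_trans H.
rewrite le_eqVlt; apply/orP; left; apply/eqP; congr (`|_|).
by rewrite [RHS]/GRing.add /= /shift/= subrK opprD addrA.
Qed.

(** Converse of [diff_nrm]: a bounded linear map that approximates f to first
   order is its differential. *)
Lemma diff_nrmP (V W : normedModType C) (f : V -> W) (x : V) (L : V -> W) (B : R) :
  linear L -> (forall h, nrm (L h) <= B * nrm h) ->
  (forall e : R, 0 < e -> exists2 dl : R, 0 < dl &
    forall y, nrm (y - x) < dl ->
      nrm (f y - f x - L (y - x)) <= e * nrm (y - x)) ->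
  differentiable f x /\ forall h, 'd f x h = L h.
Proof.
move=> linL Lb h.
pose Ll : {linear V -> W} := HB.pack L (GRing.isLinear.Build C V W *:%R L linL).
have Lc : continuous Ll.
  move=> z; apply/cvgrPdist_lt => e e0.
  have eE : (complex.Re e)%:C%C = e by rewrite RRe_real// gtr0_real.
  have re0 : 0 < complex.Re e by rewrite -ltcR eE.
  apply/near_nrmP; exists (complex.Re e / (`|B| + 1)).
    by rewrite divr_gt0// ltr_wpDl.
  move=> y yz; rewrite -eE nrm_lt -raddfB/=; apply: le_lt_trans (Lb _) _.
  rewrite ltr_pdivlMr ?ltr_wpDl// nrmBC in yz.
  by have := ler_norm B; have := nrm_ge0 (z - y); nra.
have LE : f \o shift x = cst (f x) + Ll +o_ 0 id.
  apply/eqaddoP => e e0.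
  have eE : (complex.Re e)%:C%C = e by rewrite RRe_real// gtr0_real.
  have [|dl dl0 {}h] := h (complex.Re e); first by rewrite -ltcR eE.
  apply/near_nrmP; exists dl => // y; rewrite subr0 => yd.
  have := h (y + x); rewrite addrK => /(_ yd).
  rewrite -lecR rmorphM/= -!nrmE eE => H; apply: le_trans H.
  rewrite le_eqVlt; apply/orP; left; apply/eqP; congr (`|_|).
  by rewrite [LHS]/GRing.add /= /shift/= opprD addrA.
have dE := diff_unique Lc LE.
split; last by move=> k; rewrite dE.
apply/diff_locallyP; rewrite dE; split => //.
Qed.

(** Complex derivability, in the form that is restricted to segments. *)
Definition hasD (G : C -> C) (z D : C) := forall e : R, 0 < e ->
  exists2 dl : R, 0 < dl & forall w, nrm (w - z) < dl ->
    nrm (G w - G z - D * (w - z)) <= e * nrm (w - z).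

Lemma diff_hasD (G : C -> C) (z : C) : differentiable G z -> hasD G z ('d G z 1).
Proof.
move=> /diff_nrm h e /h[dl dl0 {}h]; exists dl => // w /h.
rewrite (_ : 'd G z (w - z) = 'd G z 1 * (w - z))//.
by rewrite -[in LHS](mulr1 (w - z)) [LHS]linearZ mulrC.
Qed.

Lemma hasD_continuous G z D : hasD G z D -> forall e : R, 0 < e ->
  exists2 dl : R, 0 < dl & forall w, nrm (w - z) < dl -> nrm (G w - G z) < e.
Proof.
move=> /(_ _ ltr01)[dl dl0 h] e e0.
have n1 : 0 < 1 + nrm D by rewrite ltr_pwDl// nrm_ge0.
exists (Num.min dl (e / (1 + nrm D))); first by rewrite lt_min dl0 divr_gt0.
move=> w; rewrite lt_min => /andP[/h h1]; rewrite ltr_pdivlMr// => h2.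
have := nrmD (G w - G z - D * (w - z)) (D * (w - z)).
by rewrite subrK nrmM; nra.
Qed.

End ComplexDifferential.

Section Goursat.
Context {R : realType}.
Local Notation C := R[i].
Local Open Scope complex_scope.

Definition rect_holo (G : C -> C) (a b c d : R) := forall x y,
  a <= x <= b -> c <= y <= d -> exists D, hasD G (x +i* y) D.

(** The integral of G(z) dz along the boundary of [a, b] x [c, d]. *)
Definition rect_int (G : C -> C) (a b c d : R) : C :=
  cint a b (fun x => G (x +i* c)) + 'i * cint c d (fun y => G (b +i* y))
  - cint a b (fun x => G (x +i* d)) - 'i * cint c d (fun y => G (a +i* y)).

Lemma ccont_comp (a b : R) (g : R -> C) (G : C -> C) :
  (forall s t, nrm (g s - g t) <= `|s - t|) ->
  (forall t, a <= t <= b -> exists D, hasD G (g t) D) ->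
  ccont a b (G \o g).
Proof.
move=> g1 h t tab e e0; have [D /hasD_continuous/(_ _ e0)[dl dl0 {}h]] := h t tab.
by exists dl => // s _ st; apply: h; apply: le_lt_trans st.
Qed.

Lemma nrm_hor (y s t : R) : nrm ((s +i* y) - (t +i* y)) <= `|s - t|.
Proof.
rewrite (_ : _ - _ = (s - t)%:C); first by rewrite nrmR.
by apply/eqP; rewrite eq_complex /= subrr !eqxx.
Qed.

Lemma nrm_ver (x s t : R) : nrm ((x +i* s) - (x +i* t)) <= `|s - t|.
Proof.
rewrite (_ : _ - _ = 'i * (s - t)%:C); first by rewrite nrmM nrm_i mul1r nrmR.
by apply/eqP; rewrite eq_complex /= subrr; apply/andP; split; apply/eqP; ring.
Qed.

Section Rectangle.
Variables (G : C -> C) (a b c d : R).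
Hypothesis Gh : rect_holo G a b c d.

Lemma ccont_hor y : c <= y <= d -> ccont a b (fun x => G (x +i* y)).
Proof.
by move=> ycd; apply: (@ccont_comp _ _ (fun x => x +i* y)) => [|t tab]; [exact: nrm_hor|exact: Gh].
Qed.

Lemma ccont_ver x : a <= x <= b -> ccont c d (fun y => G (x +i* y)).
Proof.
by move=> xab; apply: (@ccont_comp _ _ (fun y => x +i* y)) => [|t tab]; [exact: nrm_ver|exact: Gh].
Qed.

Lemma rect_int_splitl m : a <= m <= b -> c <= d ->
  rect_int G a b c d = rect_int G a m c d + rect_int G m b c d.
Proof.
move=> m1 cd; rewrite /rect_int.
rewrite (cint_split m1 (ccont_hor (y := c) _)) ?lexx//.
by rewrite (cint_split m1 (ccont_hor (y := d) _)) ?lexx ?cd//; ring.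
Qed.

Lemma rect_int_splitr m : a <= b -> c <= m <= d ->
  rect_int G a b c d = rect_int G a b c m + rect_int G a b m d.
Proof.
move=> ab m1; rewrite /rect_int.
rewrite (cint_split m1 (ccont_ver (x := a) _)) ?lexx//.
by rewrite (cint_split m1 (ccont_ver (x := b) _)) ?lexx ?ab//; ring.
Qed.

End Rectangle.

Lemma rect_holo_sub G (a b c d a' b' c' d' : R) :
  rect_holo G a b c d -> a <= a' -> b' <= b -> c <= c' -> d' <= d ->
  rect_holo G a' b' c' d'.
Proof. by move=> h *; move=> x y ? ?; apply: h; lra. Qed.

Lemma cint_affine (a b : R) (k l : C) : a <= b ->
  cint a b (fun t => k + t%:C * l) = k * (b - a)%:C + l * ((b * b - a * a) / 2)%:C.
Proof.
move=> ab; rewrite (@cintE _ (fun t => k * t%:C + l * (t * t / 2)%:C))//.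
  by apply/eqP; rewrite eq_complex; case: k; case: l => /= *; apply/andP; split; apply/eqP; ring.
move=> t _.
have -> : (fun s : R => k * s%:C + l * (s * s / 2)%:C) =
   fun s => Complex (complex.Re k * s + complex.Re l * (s * s / 2))
                    (complex.Im k * s + complex.Im l * (s * s / 2)).
  apply/funext => s; case: k => k1 k2; case: l => l1 l2; apply/eqP; rewrite eq_complex /=.
  by apply/andP; split; apply/eqP; ring.
have -> : k + t%:C * l = (complex.Re k + t * complex.Re l) +i* (complex.Im k + t * complex.Im l).
  case: k => k1 k2; case: l => l1 l2; apply/eqP; rewrite eq_complex /=.
  by apply/andP; split; apply/eqP; ring.
by split; rewrite /comp /=; apply: is_derive_eq; rewrite /GRing.scale/=; field.
Qed.

Lemma rect_int_affine (k l : C) (a b c d : R) : a <= b -> c <= d ->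
  rect_int (fun w => k + l * w) a b c d = 0.
Proof.
move=> ab cd; rewrite /rect_int; case: k => k1 k2; case: l => l1 l2.
have hE y : (fun x => k1 +i* k2 + (l1 +i* l2) * (x +i* y)) =
    fun x => (k1 +i* k2 + (l1 +i* l2) * (0 +i* y)) + x%:C * (l1 +i* l2).
  apply/funext => x; apply/eqP; rewrite eq_complex; rewrite /=.
  by apply/andP; split; apply/eqP; ring.
have vE x : (fun y => k1 +i* k2 + (l1 +i* l2) * (x +i* y)) =
    fun y => (k1 +i* k2 + (l1 +i* l2) * x%:C) + y%:C * ((l1 +i* l2) * 'i).
  apply/funext => y; apply/eqP; rewrite eq_complex; rewrite /=.
  by apply/andP; split; apply/eqP; ring.
rewrite !hE !vE !cint_affine//; apply/eqP; rewrite eq_complex; rewrite /=.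
by apply/andP; split; apply/eqP; ring.
Qed.

Lemma rect_int_le (G : C -> C) (a b c d M : R) : rect_holo G a b c d ->
  a <= b -> c <= d ->
  (forall x y, a <= x <= b -> c <= y <= d -> nrm (G (x +i* y)) <= M) ->
  nrm (rect_int G a b c d) <= 4 * M * ((b - a) + (d - c)).
Proof.
move=> Gh ab cd GM.
have c1 : c <= c <= d by rewrite lexx.
have d1 : c <= d <= d by rewrite lexx cd.
have a1 : a <= a <= b by rewrite lexx.
have b1 : a <= b <= b by rewrite lexx ab.
have /= := cint_le ab (ccont_hor Gh c1) (fun x h => GM x c h c1).
have /= := cint_le ab (ccont_hor Gh d1) (fun x h => GM x d h d1).
have /= := cint_le cd (ccont_ver Gh a1) (fun y => GM a y a1).
have /= := cint_le cd (ccont_ver Gh b1) (fun y => GM b y b1).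
rewrite /rect_int; set A := cint c d _; set B := cint c d _.
set X := cint a b _; set Y := cint a b _ => hA hB hX hY.
apply: le_trans (nrmB _ _) _; rewrite nrmM nrm_i mul1r.
have := nrmB (Y + 'i * A) X; have := nrmD Y ('i * A); rewrite nrmM nrm_i mul1r.
lra.
Qed.

Lemma hasD_affine (k l z : C) : hasD (fun w => k + l * w) z l.
Proof.
move=> e e0; exists 1 => // w _.
by rewrite (_ : _ - _ - _ = 0) ?nrm0 ?mulr_ge0 ?nrm_ge0 ?ltW//; ring.
Qed.

Lemma hasDD (G H : C -> C) (z D E : C) : hasD G z D -> hasD H z E ->
  hasD (fun w => G w + H w) z (D + E).
Proof.
move=> hG hH e e0; have e2 : 0 < e / 2 by lra.
have [d1 d10 h1] := hG _ e2; have [d2 d20 h2] := hH _ e2.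
exists (Num.min d1 d2) => [|w]; first by rewrite lt_min d10.
rewrite lt_min => /andP[/h1 {}h1 /h2 {}h2].
rewrite (_ : _ - _ - _ = (G w - G z - D * (w - z)) + (H w - H z - E * (w - z))); last by ring.
by apply: le_trans (nrmD _ _) _; lra.
Qed.

Lemma rect_intD (G H : C -> C) (a b c d : R) : a <= b -> c <= d ->
  rect_holo G a b c d -> rect_holo H a b c d ->
  rect_int (fun w => G w + H w) a b c d = rect_int G a b c d + rect_int H a b c d.
Proof.
move=> ab cd Gh Hh; rewrite /rect_int.
rewrite (cintD ab (ccont_hor Gh (y := c) _) (ccont_hor Hh (y := c) _)) ?lexx//.
rewrite (cintD ab (ccont_hor Gh (y := d) _) (ccont_hor Hh (y := d) _)) ?lexx ?cd//.
rewrite (cintD cd (ccont_ver Gh (x := a) _) (ccont_ver Hh (x := a) _)) ?lexx//.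
rewrite (cintD cd (ccont_ver Gh (x := b) _) (ccont_ver Hh (x := b) _)) ?lexx ?ab//.
by ring.
Qed.

(** Near a point of differentiability the integral of a holomorphic function
   along the boundary of a small rectangle is negligible with respect to the
   square of the size: the affine part of the function contributes nothing. *)
Lemma rect_int_local (G : C -> C) (x0 y0 e : R) (D : C) : hasD G (x0 +i* y0) D ->
  0 < e -> exists2 dl, 0 < dl & forall a b c d : R,
    a <= x0 <= b -> c <= y0 <= d -> rect_holo G a b c d ->
    (b - a) + (d - c) < dl ->
    nrm (rect_int G a b c d) <= 4 * e * ((b - a) + (d - c)) ^+ 2.
Proof.
move=> hD e0; have [dl dl0 h] := hD e e0.
exists dl => // a b c d xab ycd Gh sdl.
have ab : a <= b by lra. have cd : c <= d by lra.
pose z0 := x0 +i* y0.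
pose A w := (G z0 - D * z0) + D * w.
pose r w := G w + ((- (G z0 - D * z0)) + (- D) * w).
have rh : rect_holo r a b c d.
  move=> x y hx hy; have [E hE] := Gh x y hx hy; exists (E + - D).
  by apply: hasDD => //; exact: hasD_affine.
have Ah : rect_holo A a b c d by move=> x y _ _; exists D; exact: hasD_affine.
have -> : G = fun w => r w + A w by apply/funext => w; rewrite /r /A; ring.
rewrite rect_intD// rect_int_affine// addr0.
rewrite expr2 mulrA -(mulrA 4); apply: rect_int_le => // x y hx hy.
have dist : nrm ((x +i* y) - z0) <= (b - a) + (d - c).
  apply: le_trans (nrm_le_ReIm _) _; rewrite /z0 /=.
  by apply: lerD; rewrite ler_norml; apply/andP; split; lra.
have := h _ (le_lt_trans dist sdl).
rewrite (_ : _ - _ - _ = r (x +i* y)); last by rewrite /r /z0; ring.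
by move=> /le_trans; apply; rewrite ler_wpM2l// ltW.
Qed.

Lemma rect_quarter (G : C -> C) (a b c d : R) : a <= b -> c <= d ->
  rect_holo G a b c d -> exists a' b' c' d' : R,
  [/\ a <= a' <= b' /\ b' <= b, c <= c' <= d' /\ d' <= d,
      b' - a' = (b - a) / 2, d' - c' = (d - c) / 2 &
      nrm (rect_int G a b c d) <= 4 * nrm (rect_int G a' b' c' d')].
Proof.
move=> ab cd Gh; pose m := (a + b) / 2; pose k := (c + d) / 2.
have am : a <= m <= b by rewrite /m; lra.
have ck : c <= k <= d by rewrite /k; lra.
have [am1 mb1] := andP am; have [ck1 kd1] := andP ck.
have m1 : m - a = (b - a) / 2 by rewrite /m; field.
have m2 : b - m = (b - a) / 2 by rewrite /m; field.
have k1 : k - c = (d - c) / 2 by rewrite /k; field.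
have k2 : d - k = (d - c) / 2 by rewrite /k; field.
have GL := rect_holo_sub Gh (lexx a) mb1 (lexx c) (lexx d).
have GR := rect_holo_sub Gh am1 (lexx b) (lexx c) (lexx d).
have := nrmD (rect_int G a m c d) (rect_int G m b c d).
have := nrmD (rect_int G a m c k) (rect_int G a m k d).
have := nrmD (rect_int G m b c k) (rect_int G m b k d).
rewrite -(rect_int_splitr GL am1 ck) -(rect_int_splitr GR mb1 ck).
rewrite -(rect_int_splitl Gh am cd).
clear GL GR Gh am ck; move: m k am1 mb1 ck1 kd1 m1 m2 k1 k2 => m k *.
have [w1|w1] := leP (nrm (rect_int G a b c d)) (4 * nrm (rect_int G a m c k)).
  by exists a, m, c, k; rewrite !lexx; split; rewrite ?andbT.
have [w2|w2] := leP (nrm (rect_int G a b c d)) (4 * nrm (rect_int G a m k d)).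
  by exists a, m, k, d; rewrite !lexx; split; rewrite ?andbT//; split=> //; apply/andP.
have [w3|w3] := leP (nrm (rect_int G a b c d)) (4 * nrm (rect_int G m b c k)).
  by exists m, b, c, k; rewrite !lexx; split; rewrite ?andbT//; split=> //; apply/andP.
have [w4|w4] := leP (nrm (rect_int G a b c d)) (4 * nrm (rect_int G m b k d)).
  by exists m, b, k, d; rewrite !lexx; split; rewrite ?andbT//; split=> //; apply/andP.
lra.
Qed.

(** Goursat: repeated bisection produces a nested sequence of rectangles on
   which the boundary integral decreases at most like the area; they shrink to
   a point, where differentiability makes it decrease faster. *)
Lemma goursat (G : C -> C) (a b c d : R) : a <= b -> c <= d ->
  rect_holo G a b c d -> rect_int G a b c d = 0.
Proof.
move=> ab cd Gh.
pose T := ((R * R) * (R * R))%type.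
pose good (t : T) := [/\ a <= t.1.1, t.1.1 <= t.1.2, t.1.2 <= b &
  [/\ c <= t.2.1, t.2.1 <= t.2.2 & t.2.2 <= d]].
pose I (t : T) := rect_int G t.1.1 t.1.2 t.2.1 t.2.2.
pose half (t t' : T) := [/\ good t',
  t.1.1 <= t'.1.1 /\ t'.1.2 <= t.1.2,
  t.2.1 <= t'.2.1 /\ t'.2.2 <= t.2.2,
  t'.1.2 - t'.1.1 = (t.1.2 - t.1.1) / 2 /\ t'.2.2 - t'.2.1 = (t.2.2 - t.2.1) / 2 &
  nrm (I t) <= 4 * nrm (I t')].
have step (t : T) : good t -> exists t', half t t'.
  case: t => [[a1 b1] [c1 d1]] [/= h1 h2 h3 [h4 h5 h6]].
  have [a' [b' [c' [d' [[/andP[? ?] ?] [/andP[? ?] ?] ? ? ?]]]]] :=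
    rect_quarter h2 h5 (rect_holo_sub Gh h1 h3 h4 h6).
  exists ((a', b'), (c', d')); split => //=; split => //=.
  - exact: le_trans h1 _.
  - exact: le_trans h3.
  - by split => //; [exact: le_trans h4 _|exact: le_trans h6].
pose t0 : T := ((a, b), (c, d)).
have g0 : good t0 by split.
have /choice[q qP] : forall t : T, exists t', good t -> half t t'.
  move=> t; have [/step[t' ht']|nt] := pselect (good t); first by exists t'.
  by exists t.
pose t n := iter n q t0.
have tg n : good (t n) by elim: n => [//|n /qP[]].
have th n : half (t n) (t n.+1) by apply: qP.
pose s0 := (b - a) + (d - c).
have size n : (t n).1.2 - (t n).1.1 = (b - a) / 2 ^+ n /\ (t n).2.2 - (t n).2.1 = (d - c) / 2 ^+ n.
  elim: n => [|n [e1 e2]]; first by rewrite expr0 !divr1.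
  by have [_ _ _ [-> ->] _] := th n; rewrite e1 e2 exprS; split; field.
have mono n m : (n <= m)%N -> [/\ (t n).1.1 <= (t m).1.1, (t m).1.2 <= (t n).1.2,
    (t n).2.1 <= (t m).2.1 & (t m).2.2 <= (t n).2.2].
  elim: m => [|m IH]; first by rewrite leqn0 => /eqP->.
  rewrite leq_eqVlt => /predU1P[->//|/IH[p1 p2 p3 p4]].
  have [_ [q1 q2] [q3 q4] _ _] := th m.
  by split; [exact: le_trans q1|exact: le_trans q2 _|exact: le_trans q3|exact: le_trans q4 _].
have grow n : nrm (I t0) <= 4 ^+ n * nrm (I (t n)).
  elim: n => [|n IH]; first by rewrite expr0 mul1r.
  apply: le_trans IH _; have [_ _ _ _ h] := th n.
  by rewrite exprSr -mulrA ler_wpM2l// exprn_ge0.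
have cross n m : (t n).1.1 <= (t m).1.2 /\ (t n).2.1 <= (t m).2.2.
  have [h1 h2 h3 h4] := mono _ _ (leq_maxl n m).
  have [h5 h6 h7 h8] := mono _ _ (leq_maxr n m).
  have [_ g1 _ [_ g2 _]] := tg (maxn n m).
  split; [apply: le_trans h1 (le_trans g1 h6)|apply: le_trans h3 (le_trans g2 h8)].
have nested (l r : nat -> R) : (forall n m, l n <= r m) -> exists x, forall n, l n <= x <= r n.
  move=> lr; exists (sup (range l)) => n; apply/andP; split.
    by apply: ub_le_sup; [exists (r 0%N) => _ [m _ <-]|exists n].
  by apply: ge_sup; [exists (l 0%N); exists 0%N|move=> _ [m _ <-]].
have [x0 hx0] := nested _ _ (fun n m => (cross n m).1).
have [y0 hy0] := nested _ _ (fun n m => (cross n m).2).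
have [D hD] : exists D, hasD G (x0 +i* y0) D.
  by apply: Gh; [exact: (hx0 0%N)|exact: (hy0 0%N)].
apply/eqP; rewrite -nrm_eq0 eq_le nrm_ge0 andbT.
apply/ler_addgt0Pl => e e0; rewrite addr0.
have s00 : 0 <= s0 by rewrite /s0 addr_ge0// subr_ge0.
have e0' : 0 < e / (4 * (s0 ^+ 2 + 1)) by rewrite divr_gt0// mulr_gt0// ltr_wpDl// sqr_ge0.
have [dl dl0 hdl] := rect_int_local hD e0'.
have [n hn] : exists n : nat, s0 < 2 ^+ n * dl.
  exists (Num.bound (s0 / dl)); rewrite -ltr_pdivrMr//.
  apply: lt_le_trans (archi_boundP _) _; first by rewrite divr_ge0// ltW.
  by rewrite -natrX ler_nat ltnW// ltn_expl.
have [sx sy] := size n; have [g1 g2 g3 [g4 g5 g6]] := tg n.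
have p2 : 0 < (2 ^+ n : R) by rewrite exprn_gt0.
have ss : ((t n).1.2 - (t n).1.1) + ((t n).2.2 - (t n).2.1) = s0 / 2 ^+ n.
  by rewrite sx sy -mulrDl.
have := hdl _ _ _ _ (hx0 n) (hy0 n) (rect_holo_sub Gh g1 g3 g4 g6).
rewrite ss ltr_pdivrMr// mulrC => /(_ hn) hI.
apply: le_trans (grow n) _; apply: le_trans (ler_wpM2l _ hI) _; first by rewrite exprn_ge0.
rewrite (_ : 4 ^+ n = 2 ^+ n ^+ 2); last by rewrite -exprM mulnC exprM (_ : 2 ^+ 2 = 4)//; ring.
have Q0 : 0 < s0 ^+ 2 + 1 by rewrite ltr_wpDl// sqr_ge0.
rewrite [leLHS](_ : _ = e * (s0 ^+ 2 / (s0 ^+ 2 + 1))).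
  apply: ler_piMr; first exact: ltW.
  by rewrite ler_pdivrMr// mul1r lerDl.
by field; rewrite !gt_eqF.
Qed.

End Goursat.

(** * Cauchy's formula on a circle *)

Section ComplexExponential.
Context {R : realType}.
Local Notation C := R[i].
Local Open Scope complex_scope.

Lemma is_derive_expansion (f : R -> R) (x d : R) : is_derive x 1 f d ->
  forall e : R, 0 < e -> exists2 dl : R, 0 < dl &
    forall h, `|h| < dl -> `|f (h + x) - f x - h * d| <= e * `|h|.
Proof.
move=> [/derivable1_diffP df fd] e e0.
have /eqaddoP/(_ _ e0)/nbhs_normP[dl/= dl0 H] := diff_locally df.
exists dl => // h hdl; have := H h.
rewrite /ball_/= sub0r normrN => /(_ hdl) H'; apply: le_trans H'.
rewrite le_eqVlt; apply/orP; left; apply/eqP; congr (`|_|).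
rewrite [RHS]/GRing.add /= opprD addrA /shift/=; congr (_ - _).
by rewrite -fd deriveE// -[h in RHS]mulr1 [RHS]linearZ.
Qed.

Definition cexp (z : C) : C :=
  (expR (complex.Re z))%:C * (cos (complex.Im z) +i* sin (complex.Im z)).

Lemma cexpD z w : cexp (z + w) = cexp z * cexp w.
Proof.
rewrite /cexp ReD ImD expRD cosD sinD; apply/eqP; rewrite eq_complex /=.
by apply/andP; split; apply/eqP; ring.
Qed.

Lemma cexp0 : cexp 0 = 1.
Proof.
rewrite /cexp /= expR0 cos0 sin0; apply/eqP.
by rewrite eq_complex /= !mul0r !mul1r !subr0 !addr0 !eqxx.
Qed.

Lemma nrm_cexp z : nrm (cexp z) = expR (complex.Re z).
Proof.
rewrite /cexp nrmM nrmR gtr0_norm ?expR_gt0// [X in _ * X](_ : _ = 1) ?mulr1//.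
by rewrite /nrm normc_def /= cos2Dsin2 sqrtr1.
Qed.

Lemma cexp_neq0 z : cexp z != 0.
Proof. by rewrite -nrm_gt0 nrm_cexp expR_gt0. Qed.

(** The derivative at 0 follows from the first order expansions of exp, cos and
   sin; elsewhere the addition formula reduces to this case. *)
Lemma cexp_hasD0 : hasD cexp 0 1.
Proof.
move=> e e0.
have [k [k0 k1 ke]] : exists k : R, [/\ 0 < k, k <= 1 & 9 * k <= e].
  exists (Num.min 1 (e / 9)); split.
  - by rewrite lt_min ltr01 divr_gt0.
  - by rewrite ge_min lexx.
  - by rewrite mulrC -ler_pdivlMr// ge_min lexx orbT.
have [d1 d10 h1] := is_derive_expansion (is_derive_expR 0) k0.
have [d2 d20 h2] := is_derive_expansion (is_derive_cos 0) k0.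
have [d3 d30 h3] := is_derive_expansion (is_derive_sin 0) k0.
exists (Num.min (Num.min d1 d2) (Num.min d3 k)).
  by rewrite !lt_min d10 d20 d30 k0.
move=> w; rewrite subr0 cexp0 mul1r !lt_min => /andP[/andP[w1 w2] /andP[w3 w4]].
set a := complex.Re w; set b := complex.Im w.
have an : `|a| <= nrm w by exact: Re_le_nrm.
have bn : `|b| <= nrm w by exact: Im_le_nrm.
have {h1} := h1 a (le_lt_trans an w1); rewrite addr0 expR0 mulr1.
have {h2} := h2 b (le_lt_trans bn w2); rewrite addr0 cos0 sin0 oppr0 mulr0 subr0.
have {h3} := h3 b (le_lt_trans bn w3); rewrite addr0 sin0 cos0 mulr1 subr0.
set r3 := sin b - b; set r2 := cos b - 1; set r1 := expR a - 1 - a => H3 H2 H1.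
have E1 : `|expR a| <= 3.
  rewrite (_ : expR a = r1 + (1 + a)); last by rewrite /r1; ring.
  apply: le_trans (ler_normD _ _) _; have := ler_normD 1 a; rewrite normr1.
  have : k * `|a| <= `|a| by rewrite ler_piMl.
  by lra.
apply: le_trans (nrm_le_ReIm _) _; rewrite !ReB !ImB ReM ImM /=.
rewrite -/a -/b !mul0r subr0 addr0.
rewrite (_ : expR a * cos b - 1 - a = r1 + expR a * r2); last by rewrite /r1 /r2; ring.
rewrite (_ : expR a * sin b - 0 - b = expR a * r3 + (r1 + a) * b); last by rewrite /r1 /r3; ring.
have T1 := ler_normD r1 (expR a * r2); rewrite normrM in T1.
have T2 := ler_normD (expR a * r3) ((r1 + a) * b); rewrite !normrM in T2.
have T3 : `|r1 + a| <= 2 * k.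
  apply: le_trans (ler_normD _ _) _; have : k * `|a| <= `|a| by rewrite ler_piMl.
  by lra.
have M1 : `|expR a| * `|r2| <= 3 * (k * `|b|) by rewrite ler_pM.
have M2 : `|expR a| * `|r3| <= 3 * (k * `|b|) by rewrite ler_pM.
have M3 : `|r1 + a| * `|b| <= 2 * k * `|b| by rewrite ler_wpM2r.
have N1 : k * `|a| <= k * nrm w by rewrite ler_wpM2l// ltW.
have N2 : k * `|b| <= k * nrm w by rewrite ler_wpM2l// ltW.
apply: (@le_trans _ _ (9 * k * nrm w)); last by rewrite ler_wpM2r// nrm_ge0.
clear - T1 T2 M1 M2 M3 N1 N2 H1.
lra.
Qed.

Lemma cexp_hasD z : hasD cexp z (cexp z).
Proof.
move=> e e0; have n0 : 0 < nrm (cexp z) by rewrite nrm_gt0 cexp_neq0.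
have e1 : 0 < e / nrm (cexp z) by exact: divr_gt0.
have [dl dl0 h] := cexp_hasD0 e1.
exists dl => // w wz; have := h (w - z); rewrite subr0 => /(_ wz).
move=> H; have := ler_wpM2l (ltW n0) H; rewrite -nrmM cexp0 mul1r.
rewrite [X in _ <= X](_ : _ = e * nrm (w - z)); last by field; rewrite gt_eqF.
rewrite [in X in nrm X <= _ -> _](_ : cexp z * _ = cexp w - cexp z - cexp z * (w - z))//.
have -> : cexp w = cexp z * cexp (w - z) by rewrite -cexpD addrC subrK.
by ring.
Qed.

Lemma hasD_diff (G : C -> C) (z D : C) : hasD G z D ->
  differentiable G z /\ 'd G z 1 = D.
Proof.
move=> h; have [|x|dG DE] := @diff_nrmP R C C G z (fun w => D * w) (nrm D) _ _ h.
- by move=> a x y; rewrite /GRing.scale/=; ring.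
- by rewrite nrmM.
- by split => //; rewrite DE mulr1.
Qed.

Local Notation P := (pi *+ 2 : R).

Definition circ (t : R) : C := cos t +i* sin t.

Lemma circE t : circ t = cexp (0 +i* t).
Proof. by rewrite /cexp /= expR0 mul1r. Qed.

Lemma nrm_circ t : nrm (circ t) = 1.
Proof. by rewrite circE nrm_cexp expR0. Qed.

Lemma P_ge0 : 0 <= P.
Proof. by rewrite mulrn_wge0// pi_ge0. Qed.

(** The mean of q over the circles centred at c is independent of the radius:
   in the exponential coordinate the annulus becomes a rectangle, whose
   horizontal sides cancel by periodicity. *)
Lemma circle_mean (q : C -> C) (c : C) (r : R) : 0 < r ->
  (forall z, 0 < nrm (z - c) <= r -> differentiable q z) ->
  forall A, 0 <= A -> cint 0 P (fun t => q (c + (r * expR (- A))%:C * circ t)) =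
  cint 0 P (fun t => q (c + r%:C * circ t)) /\
  ccont 0 P (fun t => q (c + (r * expR (- A))%:C * circ t)).
Proof.
move=> r0 qd A A0.
pose G s := q (c + r%:C * cexp s).
have Gh : rect_holo G (- A) 0 0 P.
  move=> x y /andP[_ x0] _; exists ('d G (x +i* y) 1); apply: diff_hasD.
  apply: (@differentiable_comp _ _ _ _ (fun s => c + r%:C * cexp s) q).
    apply: differentiableD; first exact: differentiable_cst.
    apply: differentiableM; first exact: differentiable_cst.
    by have [] := hasD_diff (cexp_hasD (x +i* y)).
  apply: qd; rewrite addrC addKr nrmM nrmR nrm_cexp gtr0_norm//=.
  rewrite mulr_gt0 ?expR_gt0//=; apply: ler_piMr; first exact: ltW.
  by rewrite -(@expR0 R) ler_expR.
have vE x : (fun y => G (x +i* y)) = fun y => q (c + (r * expR x)%:C * circ y).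
  apply/funext => y; rewrite /G /cexp /circ /=; congr (q (c + _)).
  rewrite mulrA; congr (_ * _); apply/eqP; rewrite eq_complex /=.
  by apply/andP; split; apply/eqP; ring.
have A00 : - A <= 0 by rewrite oppr_le0.
have hE : (fun x => G (x +i* P)) = (fun x => G (x +i* 0)).
  by apply/funext => x; rewrite /G /cexp /= cos2pi sin2pi cos0 sin0.
clearbody G.
have vA := vE (- A); have v0 := vE 0; rewrite expR0 mulr1 in v0.
rewrite -vA -v0.
split; last by apply: (ccont_ver Gh); rewrite lexx A00.
have := goursat A00 P_ge0 Gh; rewrite /rect_int hE.
rewrite (addrC (cint (- A) 0 _)) addrK -mulrBr => /eqP; rewrite mulf_eq0 => /orP[|].
  by rewrite -nrm_eq0 nrm_i oner_eq0.
by rewrite subr_eq0 => /eqP.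
Qed.

Lemma cint_cst (a b : R) (k : C) : a <= b -> cint a b (fun=> k) = k * (b - a)%:C.
Proof.
move=> ab; have := @cint_affine R a b k 0 ab.
by under eq_fun do rewrite mulr0 addr0; rewrite mul0r addr0.
Qed.

Lemma ccont_cst (a b : R) (k : C) : ccont a b (fun=> k).
Proof. by move=> t _ e e0; exists 1 => // s _ _; rewrite subrr nrm0. Qed.

Lemma ccontD (a b : R) (p q : R -> C) : ccont a b p -> ccont a b q ->
  ccont a b (fun t => p t + q t).
Proof.
move=> pc qc t tab e e0; have e2 : 0 < e / 2 by rewrite divr_gt0.
have [d1 d10 h1] := pc t tab _ e2; have [d2 d20 h2] := qc t tab _ e2.
exists (Num.min d1 d2) => [|s sab]; first by rewrite lt_min d10.
rewrite lt_min => /andP[/(h1 s sab) {}h1 /(h2 s sab) {}h2].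
rewrite opprD addrACA; apply: le_lt_trans (nrmD _ _) _; lra.
Qed.

Lemma ccontM (a b : R) (p q : R -> C) (M : R) : ccont a b p -> ccont a b q ->
  (forall t, a <= t <= b -> nrm (q t) <= M) ->
  ccont a b (fun t => p t * q t).
Proof.
move=> pc qc qM t tab e e0; have M0 : 0 <= M by apply: le_trans (qM t tab); exact: nrm_ge0.
pose k := M + nrm (p t) + 1.
have k0 : 0 < k by rewrite /k ltr_pwDr// addr_ge0// nrm_ge0.
have e2 : 0 < e / (2 * k) by rewrite divr_gt0// mulr_gt0.
have [d1 d10 h1] := pc t tab _ e2; have [d2 d20 h2] := qc t tab _ e2.
exists (Num.min d1 d2) => [|s sab]; first by rewrite lt_min d10.
rewrite lt_min => /andP[/(h1 s sab) {}h1 /(h2 s sab) {}h2].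
rewrite (_ : _ - _ = (p s - p t) * q s + p t * (q s - q t)); last by ring.
apply: le_lt_trans (nrmD _ _) _; rewrite !nrmM.
have B1 : nrm (p s - p t) * nrm (q s) <= e / (2 * k) * k.
  apply: ler_pM; rewrite ?nrm_ge0 ?ltW//; apply: le_lt_trans (qM s sab) _.
  by rewrite /k -addrA ltrDl ltr_wpDl// nrm_ge0.
have B2 : nrm (p t) * nrm (q s - q t) < k * (e / (2 * k)).
  apply: (@le_lt_trans _ _ (k * nrm (q s - q t))); last by rewrite ltr_pM2l.
  by rewrite ler_wpM2r ?nrm_ge0// /k -addrA addrCA lerDl addr_ge0.
have : e / (2 * k) * k = e / 2 by field; rewrite gt_eqF.
by rewrite (mulrC k) in B2; lra.
Qed.

Lemma ccont_circN : ccont 0 P (fun t => circ (- t)).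
Proof.
have -> : (fun t => circ (- t)) = cexp \o (fun t => 0 +i* (- t)).
  by apply/funext => t; rewrite circE.
apply: ccont_comp => [s t|t _]; last by exists (cexp (0 +i* (- t))); exact: cexp_hasD.
by apply: le_trans (nrm_ver _ _ _) _; rewrite -opprD normrN.
Qed.

Lemma circV t : (circ t)^-1 = circ (- t).
Proof.
have c0 : circ t != 0 by rewrite circE cexp_neq0.
apply: (mulfI c0); rewrite divff// !circE -cexpD -cexp0; congr cexp.
by apply/eqP; rewrite eq_complex /= addr0 subrr !eqxx.
Qed.

Lemma cint_circN : cint 0 P (fun t => circ (- t)) = 0.
Proof.
rewrite (@cintE _ (fun t => sin t +i* cos t)) ?P_ge0//.
  by rewrite cos2pi sin2pi cos0 sin0 subrr.
move=> t _; rewrite /circ cosN sinN; split; rewrite /comp /=.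
  exact: is_derive_sin.
exact: is_derive_cos.
Qed.

End ComplexExponential.


Section CauchyDerivative.
Context {R : realType}.
Local Notation C := R[i].
Local Notation P := (pi *+ 2 : R).
Local Open Scope complex_scope.

(** Cauchy's formula for the derivative at the centre of a circle: the means of
   the difference quotient (g z - g c) / (z - c) are independent of the radius
   and tend to the derivative when the radius tends to 0. *)
Lemma circle_derive (g : C -> C) (c : C) (r : R) : 0 < r ->
  (forall z, nrm (z - c) <= r -> differentiable g z) ->
  ccont 0 P (fun t => g (c + r%:C * circ t)) /\
  cint 0 P (fun t => g (c + r%:C * circ t) * circ (- t)) = (r * P)%:C * 'd g c 1.
Proof.
move=> r0 gd.
have [_ gc] := @circle_mean R g c r r0 (fun z h => gd z (andP h).2) 0 (lexx _).
rewrite oppr0 expR0 mulr1 in gc; split => //.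
pose q z := (g z - g c) * (z - c)^-1.
have qd z : 0 < nrm (z - c) <= r -> differentiable q z.
  rewrite nrm_gt0 => /andP[z0 zr]; apply: differentiableM.
    by apply: differentiableB; [exact: gd|exact: differentiable_cst].
  apply: (@differentiableV _ _ (fun y => y - c)); last exact: z0.
  by apply: differentiableB => //; exact: differentiable_cst.
set D := 'd g c 1.
have gD : hasD g c D by apply: diff_hasD; apply: gd; rewrite subrr nrm0 ltW.
have [_ qc0] := circle_mean r0 qd (lexx 0); rewrite oppr0 expR0 mulr1 in qc0.
have I0E : cint 0 P (fun t => q (c + r%:C * circ t)) = D * P%:C.
  apply/eqP; rewrite -subr_eq0 -nrm_eq0 eq_le nrm_ge0 andbT.
  apply/ler_addgt0Pl => e e0; rewrite addr0.
  have p0 : 0 < 2 * P + 1 by have := @P_ge0 R; lra.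
  have [dl dl0 h] := gD _ (divr_gt0 e0 p0).
  (* a circle on which the difference quotient is close to the derivative *)
  have x0 : 0 < dl / (2 * r) by rewrite divr_gt0// mulr_gt0.
  have [A [A0 Adl]] : exists A, 0 <= A /\ expR (- A) <= dl / (2 * r).
    exists (Num.max 0 (- ln (dl / (2 * r)))); rewrite le_max lexx; split => //.
    by rewrite -[leRHS]lnK ?posrE// ler_expR lerNl le_max lexx orbT.
  have rA : 0 < r * expR (- A) by rewrite mulr_gt0 ?expR_gt0.
  have rdl : r * expR (- A) < dl.
    apply: (@le_lt_trans _ _ (r * (dl / (2 * r)))); first by rewrite ler_pM2l.
    by rewrite (_ : r * _ = dl / 2); [lra|field; rewrite gt_eqF].
  have [<- qc] := circle_mean r0 qd A0.
  have -> : - (D * P%:C) = cint 0 P (fun=> - D) by rewrite cint_cst ?P_ge0// subr0 mulNr.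
  rewrite -cintD ?P_ge0//; last exact: ccont_cst.
  apply: (@le_trans _ _ (2 * (e / (2 * P + 1)) * (P - 0))); last first.
    have := @P_ge0 R; move: p0; move: (P) => p p0 pg.
    rewrite subr0 [leLHS](_ : _ = e * (2 * p) / (2 * p + 1)); last by field; rewrite gt_eqF.
    rewrite ler_pdivrMr//; apply: ler_wpM2l; first exact: ltW.
    by rewrite lerDl.
  apply: cint_le; [exact: P_ge0|by apply: ccontD => //; exact: ccont_cst|move=> t _].
  set z := c + _; have zc : z - c = (r * expR (- A))%:C * circ t by rewrite /z addrC addKr.
  have nz : nrm (z - c) = r * expR (- A).
    by rewrite zc nrmM nrmR nrm_circ mulr1 gtr0_norm.
  have z0 : z - c != 0 by rewrite -nrm_gt0 nz.
  have := h z; rewrite nz => /(_ rdl) {}h.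
  rewrite (_ : q z + _ = (g z - g c - D * (z - c)) * (z - c)^-1); last first.
    by rewrite /q; field.
  by rewrite nrmM nrmV nz ler_pdivrMr.
have rC : r%:C != 0 :> C by rewrite -nrm_gt0 nrmR gtr0_norm.
have {I0E} : r%:C * cint 0 P (fun t => q (c + r%:C * circ t)) = (r * P)%:C * D.
  by rewrite I0E rmorphM /=; ring.
have gcc : ccont 0 P (fun t => g (c + r%:C * circ t) * circ (- t)).
  by apply: (ccontM (M := 1)) => //; [exact: ccont_circN|move=> t _; rewrite nrm_circ].
rewrite -cintZ ?P_ge0// => <-.
have -> : cint 0 P (fun t => r%:C * q (c + r%:C * circ t)) =
    cint 0 P (fun t => g (c + r%:C * circ t) * circ (- t) + - g c * circ (- t)).
  apply: cint_eq => t _; rewrite /q (addrC c) addrK -circV.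
  by field; rewrite rC /= circE cexp_neq0.
rewrite cintD ?P_ge0//.
  by rewrite cintZ ?P_ge0 ?cint_circN ?mulr0 ?addr0//; exact: ccont_circN.
by apply: (ccontM (M := 1)); [exact: ccont_cst|exact: ccont_circN|move=> t _; rewrite nrm_circ].
Qed.

End CauchyDerivative.

(** * Holomorphic functions are smooth *)

Section Cauchy.
Context {R : realType}.
Local Notation C := R[i].
Local Notation P := (pi *+ 2 : R).
Local Open Scope complex_scope.

Lemma expansion_is_derive (f : R -> R) (x d : R) :
  (forall e : R, 0 < e -> exists2 dl : R, 0 < dl &
    forall h, `|h| < dl -> `|f (h + x) - f x - h * d| <= e * `|h|) ->
  is_derive x 1 f d.
Proof.
move=> H.
suff cv : (fun h => h^-1 *: ((f \o shift x) (h *: (1:R)) - f x)) @ 0^' --> d.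
  by split; [apply/cvg_ex; exists d|apply/cvg_lim].
apply/cvgrPdist_le => e e0; have [dl dl0 h] := H e e0.
exists dl => //= y; rewrite /ball_/= sub0r normrN => ydl y0.
rewrite /shift/= [_ *: 1]mulr1 distrC -(@ler_pM2l _ `|y|) ?normr_gt0// -normrM.
rewrite mulrBr /GRing.scale/= mulrA divff// mul1r (mulrC _ e).
exact: h.
Qed.

(** A complex derivative is in particular a derivative along the real axis. *)
Lemma hasD_cderiv (g : C -> C) (t : R) (D : C) : hasD g t%:C D ->
  cderiv (fun s => g s%:C) t D.
Proof.
move=> h; split; apply: expansion_is_derive => e e0.
  have [dl dl0 {}h] := h e e0; exists dl => // y ydl.
  have yE : (y + t)%:C - t%:C = y%:C by rewrite -rmorphB addrK.
  have := h (y + t)%:C; rewrite yE nrmR => /(_ ydl); apply: le_trans => /=.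
  have := Re_le_nrm (g (y + t)%:C - g t%:C - D * y%:C).
  by rewrite !ReB ReM /= mulr0 subr0 (mulrC y).
have [dl dl0 {}h] := h e e0; exists dl => // y ydl.
have yE : (y + t)%:C - t%:C = y%:C by rewrite -rmorphB addrK.
have := h (y + t)%:C; rewrite yE nrmR => /(_ ydl); apply: le_trans => /=.
have := Im_le_nrm (g (y + t)%:C - g t%:C - D * y%:C).
by rewrite !ImB ImM /= mulr0 add0r (mulrC y).
Qed.

Lemma ccont_lip (a b : R) (p q : R -> C) (N : R) : ccont a b q ->
  (forall s t, nrm (p s - p t) <= N * nrm (q s - q t)) -> ccont a b p.
Proof.
move=> qc pq t tab e e0; have N0 : 0 < `|N| + 1 by rewrite ltr_wpDl.
have [dl dl0 h] := qc t tab _ (divr_gt0 e0 N0).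
exists dl => // s sab st; apply: le_lt_trans (pq _ _) _.
have := h s sab st; rewrite ltr_pdivlMr// mulrC; apply: le_lt_trans.
by rewrite ler_wpM2r ?nrm_ge0// (le_trans (ler_norm N))// lerDl.
Qed.

Lemma ccont_circ : ccont 0 P circ.
Proof.
have -> : circ = cexp \o (fun t : R => 0 +i* t) by apply/funext => t; rewrite circE.
apply: ccont_comp => [s t|t _]; first exact: nrm_ver.
by exists (cexp (0 +i* t)); exact: cexp_hasD.
Qed.

(** The integral of p(t) exp(-it) over [0, 2 pi], the linear form of Cauchy's
   formula. *)
Definition circ_int (p : R -> C) : C := cint 0 P (fun t => p t * circ (- t)).

Lemma ccont_circM p : ccont 0 P p -> ccont 0 P (fun t => p t * circ (- t)).
Proof.
by move=> pc; apply: (ccontM (M := 1)) => //; [exact: ccont_circN|move=> t _; rewrite nrm_circ].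
Qed.

Lemma circ_intD p q : ccont 0 P p -> ccont 0 P q ->
  circ_int (fun t => p t + q t) = circ_int p + circ_int q.
Proof.
move=> pc qc; rewrite /circ_int -cintD ?P_ge0//; [|exact: ccont_circM..].
by apply: cint_eq => t _; rewrite mulrDl.
Qed.

Lemma ccontZ (k : C) p : ccont 0 P p -> ccont 0 P (fun t => k * p t).
Proof.
move=> pc t tP e e0; have k0 : 0 < nrm k + 1 by rewrite ltr_wpDl// nrm_ge0.
have [dl dl0 h] := pc t tP _ (divr_gt0 e0 k0).
exists dl => // s sP st; rewrite -mulrBr nrmM.
have := h s sP st; rewrite ltr_pdivlMr// mulrC => H; apply: le_lt_trans H.
by rewrite ler_wpM2r ?nrm_ge0// lerDl.
Qed.

Lemma circ_intZ (k : C) p : ccont 0 P p ->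
  circ_int (fun t => k * p t) = k * circ_int p.
Proof.
move=> pc; rewrite /circ_int -cintZ ?P_ge0//; last exact: ccont_circM.
by apply: cint_eq => t _; rewrite mulrA.
Qed.

Lemma ccontB p q : ccont 0 P p -> ccont 0 P q -> ccont 0 P (fun t => p t - q t).
Proof.
move=> pc qc; under eq_fun do rewrite -mulN1r.
by apply: ccontD => //; exact: ccontZ.
Qed.

Lemma circ_intB p q : ccont 0 P p -> ccont 0 P q ->
  circ_int (fun t => p t - q t) = circ_int p - circ_int q.
Proof.
move=> pc qc; rewrite -mulN1r -circ_intZ// -circ_intD//; last exact: ccontZ.
by congr circ_int; apply/funext => t; rewrite mulN1r.
Qed.

Lemma circ_int_le (p : R -> C) (N : R) : ccont 0 P p ->
  (forall t, nrm (p t) <= N) -> nrm (circ_int p) <= 2 * N * P.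
Proof.
move=> pc pN; rewrite -[X in _ * X]subr0; apply: cint_le; first exact: P_ge0.
  exact: ccont_circM.
by move=> t _; rewrite nrmM nrm_circ mulr1.
Qed.

Section Line.
Variables (V : normedModType C) (f : V -> C) (x e : V).

Lemma diff_line (z : C) : differentiable f (x + z *: e) ->
  differentiable (fun w : C => f (x + w *: e)) z /\
  'd (fun w : C => f (x + w *: e)) z 1 = 'd f (x + z *: e) e.
Proof.
move=> df.
have dl : differentiable (fun w : C => x + w *: e) z.
  apply: differentiableD; first exact: differentiable_cst.
  exact: differentiableZl.
have dc : differentiable (fun w : C => f (x + w *: e)) z.
  exact: (@differentiable_comp _ _ _ _ (fun w : C => x + w *: e) f z dl df).
split => //.
rewrite -(deriveE (1 : C) dc) -(deriveE e df) /derive.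
set F := (X in X @ 0^'); set G := (X in _ = lim (X @ 0^')).
suff -> : F = G by [].
apply/funext => h; rewrite /F /G /= /shift/=; congr (_ *: (f _ - _)).
have -> : h *: 1 = h by exact: mulr1.
by rewrite scalerDl addrCA.
Qed.

(** Cauchy's formula on the complex line through x with direction e. *)
Lemma circle_diff (r : R) : 0 < r ->
  (forall y, nrm (y - x) <= r * nrm e -> differentiable f y) ->
  ccont 0 P (fun t => f (x + (r%:C * circ t) *: e)) /\
  circ_int (fun t => f (x + (r%:C * circ t) *: e)) =
    (r * P)%:C * 'd f x e.
Proof.
move=> r0 df; pose g z := f (x + z *: e).
have gd z : nrm (z - 0) <= r -> differentiable g z.
  rewrite subr0 => zr; apply: (diff_line _).1; apply: df.
  by rewrite (addrC x) addrK nrmZ ler_wpM2r// nrm_ge0.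
have [] := circle_derive r0 gd; rewrite (diff_line _).2; last first.
  by apply: df; rewrite scale0r addr0 subrr nrm0 mulr_ge0 ?nrm_ge0 ?ltW.
rewrite scale0r addr0.
rewrite /circ_int; under eq_fun do rewrite add0r.
by under [X in cint _ _ X]eq_fun do rewrite add0r.
Qed.

End Line.

(** In the estimates below f is holomorphic and bounded by M on the ball of
   radius 4 rho about x0. Circles of radius rho about points of a smaller ball
   stay inside, so each use of Cauchy's formula costs one rho: the bound on f on
   4 rho bounds the differential on 3 rho; f is then Lipschitz on 3 rho, which
   makes the differential Lipschitz on 2 rho. *)
Section LocalEstimates.
Variables (V : normedModType C) (f : V -> C) (x0 : V) (rho M : R).
Hypotheses (rho0 : 0 < rho) (M0 : 0 <= M).
Let B (s : R) : set V := [set y | nrm (y - x0) < s].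
Hypothesis fd : forall y, B (4 * rho) y -> differentiable f y.
Hypothesis fM : forall y, B (4 * rho) y -> nrm (f y) <= M.

Lemma ballD s t y z : B s y -> nrm (z - y) <= t -> B (s + t) z.
Proof.
rewrite /B/= => ys zy; rewrite (_ : z - x0 = (z - y) + (y - x0)); last by rewrite addrA subrK.
by apply: le_lt_trans (nrmD _ _) _; rewrite addrC ltr_leD.
Qed.

Lemma ball_segment s y h (t : R) : B s y -> B s (y + h) -> 0 <= t <= 1 ->
  B s (y + t%:C *: h).
Proof.
rewrite /B/= => ys yhs /andP[t0 t1].
rewrite (_ : _ - x0 = (1 - t)%:C *: (y - x0) + t%:C *: (y + h - x0)); last first.
  rewrite [y + h - x0]addrAC [LHS]addrAC; move: (y - x0) => a.
  by rewrite scalerDr addrA -scalerDl -rmorphD subrK scale1r.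
apply: le_lt_trans (nrmD _ _) _; rewrite !nrmZ !nrmR !ger0_norm ?subr_ge0//.
have [->|tn1] := eqVneq t 1; first by rewrite subrr mul0r add0r mul1r.
have t1' : 0 < 1 - t by rewrite subr_gt0 lt_neqAle tn1.
have : (1 - t) * nrm (y - x0) < (1 - t) * s by rewrite ltr_pM2l.
have : t * nrm (y + h - x0) <= t * s by rewrite ler_wpM2l// ltW.
lra.
Qed.

Lemma circle_in s y h t : h != 0 -> B s y ->
  B (s + rho) (y + ((rho / nrm h)%:C * circ t) *: h).
Proof.
move=> h0 ys; apply: ballD ys _; rewrite (addrC y) addrK nrmZ nrmM nrm_circ mulr1 nrmR.
by rewrite gtr0_norm ?divr_gt0 ?nrm_gt0// divfK ?nrm_eq0.
Qed.

Lemma circle_ball s y h : h != 0 -> B s y -> s + rho <= 4 * rho ->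
  ccont 0 P (fun t => f (y + ((rho / nrm h)%:C * circ t) *: h)) /\
  circ_int (fun t => f (y + ((rho / nrm h)%:C * circ t) *: h)) =
    (rho / nrm h * P)%:C * 'd f y h.
Proof.
move=> h0 ys ss; apply: circle_diff => [|z]; first by rewrite divr_gt0 ?nrm_gt0.
rewrite divfK ?nrm_eq0// => zy; apply: fd.
by have := ballD ys zy; rewrite /B/= => /lt_le_trans; exact.
Qed.

Lemma P_gt0 : 0 < P.
Proof. by rewrite mulrn_wgt0// pi_gt0. Qed.

Lemma circ_bound (h : V) (N : R) (v : C) : h != 0 ->
  nrm ((rho / nrm h * P)%:C * v) <= 2 * N * P -> nrm v <= 2 * N / rho * nrm h.
Proof.
move=> h0; have hn : 0 < nrm h by rewrite nrm_gt0.
have q0 : 0 < rho / nrm h by rewrite divr_gt0.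
have qP : 0 < rho / nrm h * P by exact: mulr_gt0 q0 P_gt0.
rewrite nrmM nrmR (gtr0_norm qP) mulrAC (ler_pM2r P_gt0) => H.
rewrite -(ler_pM2l q0); apply: le_trans H _.
by rewrite le_eqVlt; apply/orP; left; apply/eqP; field; rewrite !gt_eqF.
Qed.

Lemma diff_bound y h : B (3 * rho) y -> nrm ('d f y h) <= 2 * M / rho * nrm h.
Proof.
move=> y3; have [->|h0] := eqVneq h 0; first by rewrite linear0 !nrm0 mulr0.
have s4 : 3 * rho + rho <= 4 * rho by lra.
have [fc fE] := circle_ball h0 y3 s4.
apply: circ_bound => //; rewrite -fE; apply: circ_int_le => // t; apply: fM.
by rewrite (_ : 4 * rho = 3 * rho + rho); [exact: circle_in|ring].
Qed.

Let rho34 : 3 * rho < 4 * rho. Proof. by have := rho0; lra. Qed.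
Let rho23 : 2 * rho < 3 * rho. Proof. by have := rho0; lra. Qed.
Let rho24 : 2 * rho + rho <= 4 * rho. Proof. by have := rho0; lra. Qed.
Let rho14 : rho + rho <= 4 * rho. Proof. by have := rho0; lra. Qed.
Let rho14' : rho <= 4 * rho. Proof. by have := rho0; lra. Qed.
Let rho04 : 0 < 4 * rho. Proof. by have := rho0; lra. Qed.

Let K := 4 * M / rho.

(** Mean value inequality along the segment from y to y + h, for f minus the
   linear map with value L at h. *)
Lemma seg_mvi y h (L : C) (N : R) : B (3 * rho) y -> B (3 * rho) (y + h) ->
  (forall t, 0 <= t <= 1 -> nrm ('d f (y + t%:C *: h) h - L) <= N) ->
  nrm (f (y + h) - f y - L) <= 2 * N.
Proof.
move=> y3 yh3 HN.
have := @cderiv_mvi R (fun t => f (y + t%:C *: h) + (- L) * t%:C)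
  (fun t => 'd f (y + t%:C *: h) h - L) 0 1 N ler01.
rewrite subr0 mulr1 scale1r scale0r addr0 mulr0 mulr1 addr0 addrAC.
apply=> // t t01.
have df : differentiable f (y + t%:C *: h).
  apply: fd; have := ball_segment y3 yh3 t01; rewrite /B/= => /lt_trans; apply.
  exact: rho34.
have [dg dgE] := diff_line df.
apply: cderivD.
  by rewrite -dgE; apply: (@hasD_cderiv (fun z => f (y + z *: h))); exact: diff_hasD.
have := cderiv_affine 0 (- L) t.
by under eq_fun do rewrite add0r mulrC.
Qed.

Lemma f_lip y z : B (3 * rho) y -> B (3 * rho) z -> nrm (f z - f y) <= K * nrm (z - y).
Proof.
move=> y3 z3; have zE : z = y + (z - y) by rewrite addrC subrK.
have := @seg_mvi y (z - y) 0 (2 * M / rho * nrm (z - y)) y3.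
rewrite -zE => /(_ z3); rewrite subr0.
rewrite [X in _ -> _ <= X](_ : _ = 2 * (2 * M / rho * nrm (z - y))); last by rewrite /K; ring.
apply=> t t01; rewrite subr0; apply: diff_bound.
by apply: ball_segment => //; rewrite -zE.
Qed.

Let K2 := 2 * K / rho.

Let K2_ge0 : 0 <= K2.
Proof.
have rho1 := ltW rho0.
by apply: divr_ge0 => //; apply: mulr_ge0 => //; apply: divr_ge0 => //; apply: mulr_ge0.
Qed.

Lemma diff_lip y z h : B (2 * rho) y -> B (2 * rho) z ->
  nrm ('d f z h - 'd f y h) <= K2 * nrm h * nrm (z - y).
Proof.
move=> y2 z2; have [->|h0] := eqVneq h 0.
  by rewrite (linear0 ('d f z)) (linear0 ('d f y)) subrr !nrm0 mulr0 mul0r.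
have s4 := rho24.
have [yc yE] := circle_ball h0 y2 s4; have [zc zE] := circle_ball h0 z2 s4.
rewrite mulrAC (_ : K2 * _ = 2 * (K * nrm (z - y)) / rho); last by rewrite /K2; ring.
apply: circ_bound => //; rewrite mulrBr -yE -zE -circ_intB//.
apply: circ_int_le => [|t]; first exact: ccontB.
set c := (_ * circ t) *: h.
rewrite [X in K * nrm X](_ : _ = (z + c) - (y + c)); last by rewrite opprD addrACA subrr addr0.
by apply: f_lip; rewrite (_ : 3 * rho = 2 * rho + rho);
  [exact: circle_in|ring|exact: circle_in|ring].
Qed.

(** The quadratic bound is uniform in y, which allows it to be integrated over a
   circle. *)
Lemma diff_quad y h : B (2 * rho) y -> B (2 * rho) (y + h) ->
  nrm (f (y + h) - f y - 'd f y h) <= 2 * K2 * nrm h ^+ 2.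
Proof.
move=> y2 yh2; rewrite -mulrA.
have lt23 s : B (2 * rho) s -> B (3 * rho) s by rewrite /B/= => /lt_trans; apply; exact: rho23.
have K20 := K2_ge0.
apply: seg_mvi => [||t t01]; [exact: lt23|exact: lt23|].
apply: le_trans (diff_lip _ y2 _) _; first exact: ball_segment.
rewrite (addrC y) addrK nrmZ nrmR expr2 -mulrA; apply: ler_wpM2l => //.
apply: ler_wpM2l; first exact: nrm_ge0.
by case/andP: t01 => t0 t1; rewrite ger0_norm// ler_piMl// nrm_ge0.
Qed.

Variable e : V.
Hypothesis e0 : e != 0.

Let r := rho / nrm e.
Let p t := x0 + (r%:C * circ t) *: e.

Let x0B s : 0 < s -> B s x0. Proof. by rewrite /B/= subrr nrm0. Qed.

Let pB t : B (2 * rho) (p t).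
Proof.
by rewrite (_ : 2 * rho = rho + rho); [apply: circle_in => //; exact: x0B|ring].
Qed.

Lemma ccont_diff h : ccont 0 P (fun t => 'd f (p t) h).
Proof.
apply: (@ccont_lip _ _ _ circ (K2 * nrm h * (r * nrm e)) ccont_circ) => s t.
apply: le_trans (diff_lip _ (pB t) (pB s)) _.
rewrite (_ : p s - p t = (r%:C * (circ s - circ t)) *: e); last first.
  by rewrite /p opprD addrACA subrr add0r -scalerBl mulrBr.
rewrite nrmZ nrmM nrmR gtr0_norm ?divr_gt0 ?nrm_gt0//.
by rewrite le_eqVlt; apply/orP; left; apply/eqP; ring.
Qed.

(** Cauchy's formula differentiated under the integral sign; by
   [derive_differentiable] this is the differential of the directional derivative along e. *)
Definition deriv_op (h : V) : C := ((r * P)%:C)^-1 * circ_int (fun t => 'd f (p t) h).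

Let rP0 : (r * P)%:C != 0 :> C.
Proof.
by rewrite -nrm_gt0 nrmR normr_gt0 mulf_neq0 ?gt_eqF ?P_gt0// divr_gt0 ?nrm_gt0.
Qed.

Lemma deriv_opE h : (r * P)%:C * deriv_op h = circ_int (fun t => 'd f (p t) h).
Proof. by rewrite /deriv_op mulrA divff// mul1r. Qed.

Lemma deriv_op_linear : linear deriv_op.
Proof.
move=> a h k; rewrite /deriv_op; under [in LHS]eq_fun do rewrite linearP.
rewrite circ_intD; [|exact/ccontZ/ccont_diff|exact: ccont_diff].
by rewrite circ_intZ; [rewrite /GRing.scale/=; ring|exact: ccont_diff].
Qed.

Lemma deriv_op_le h : nrm (deriv_op h) <= 2 * (2 * M / rho * nrm h) / rho * nrm e.
Proof.
apply: circ_bound => //; rewrite deriv_opE; apply: circ_int_le => [|t]; first exact: ccont_diff.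
by apply: diff_bound; have := pB t; rewrite /B/= => /lt_trans; apply; exact: rho23.
Qed.

(** By Cauchy's formula the first order remainder of the derivative along e is
   the circle integral of that of f, which is uniformly quadratic. *)
Lemma derive_differentiable :
  differentiable ('D_e f) x0 /\ forall h, 'd ('D_e f) x0 h = deriv_op h.
Proof.
apply: (@diff_nrmP R V C ('D_e f) x0 deriv_op (2 * (2 * M / rho) / rho * nrm e)).
- exact: deriv_op_linear.
- move=> h; apply: le_trans (deriv_op_le h) _.
  by rewrite le_eqVlt; apply/orP; left; apply/eqP; ring.
move=> eps eps0.
pose K3 := 2 * (2 * K2) / rho * nrm e.
have K30 : 0 <= K3.
  apply: mulr_ge0; last exact: nrm_ge0.
  by apply: divr_ge0; [do 2 apply: mulr_ge0 => //|exact: ltW].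
have K31 : 0 < K3 + 1 by rewrite ltr_wpDl.
exists (Num.min rho (eps / (K3 + 1))); first by rewrite lt_min rho0 divr_gt0.
move=> y; rewrite lt_min ltr_pdivlMr// => /andP[y1 y2].
pose h := y - x0; have yE : y = x0 + h by rewrite /h addrC subrK.
have B4 s : s <= 4 * rho -> B s `<=` B (4 * rho) by move=> s4 z /lt_le_trans; exact.
rewrite !deriveE; [|apply: fd; apply: x0B; exact: rho04|apply: fd; exact: (B4 _ rho14')].
rewrite -/h; apply: (@le_trans _ _ (2 * (2 * K2 * nrm h ^+ 2) / rho * nrm e)); last first.
  rewrite [leLHS](_ : _ = K3 * nrm h * nrm h); last by rewrite /K3; ring.
  rewrite ler_wpM2r ?nrm_ge0//; rewrite -/h in y2.
  by have := nrm_ge0 h; nra.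
apply: circ_bound => //.
have s4 := rho14.
have [c0 E0] := circle_ball e0 (x0B rho0) s4.
have [c1 E1] := circle_ball e0 (y1 : B rho y) s4.
rewrite !mulrBr deriv_opE -E0 -E1 -circ_intB// -circ_intB//; [|exact: ccontB|exact: ccont_diff].
apply: circ_int_le => [|t]; first by apply: ccontB; [exact: ccontB|exact: ccont_diff].
rewrite -/r -/(p t) (_ : y + _ = p t + h); last by rewrite yE /p addrAC.
apply: diff_quad; first exact: pB.
have := circle_in t e0 (y1 : B rho y); rewrite yE addrAC -/r -/(p t).
by rewrite (_ : 2 * rho = rho + rho)//; ring.
Qed.

End LocalEstimates.

Lemma local_bound (V : normedModType C) (f : V -> C) (x0 : V) :
  (\forall y \near x0, differentiable f y) -> exists rho M : R,
  [/\ 0 < rho, 0 <= M, forall y, nrm (y - x0) < 4 * rho -> differentiable f y &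
    forall y, nrm (y - x0) < 4 * rho -> nrm (f y) <= M].
Proof.
move=> /near_nrmP[d1 d10 h1].
have [|d2 d20 h2] := diff_nrm (h1 x0 _) ltr01; first by rewrite subrr nrm0.
have fc : {for x0, continuous f}.
  by apply: differentiable_continuous; apply: h1; rewrite subrr nrm0.
move/cvgrPdist_lt : fc => /(_ 1 ltr01)/near_nrmP[d3 d30 h3].
exists (Num.min d1 d3 / 4), (nrm (f x0) + 1).
have m0 : 0 < Num.min d1 d3 by rewrite lt_min d10.
split => [|||].
- by rewrite divr_gt0.
- by rewrite addr_ge0// nrm_ge0.
- by move=> y; rewrite mulrC divfK// lt_min => /andP[/h1].
- move=> y; rewrite mulrC divfK// lt_min => /andP[_ /h3].
  rewrite -[1]/(1%:C) nrm_lt => H.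
  rewrite -[f y](subrK (f x0)) addrC; apply: le_trans (nrmD _ _) _.
  by rewrite lerD2l nrmBC ltW.
Qed.

Lemma holo_derive (V : normedModType C) (f : V -> C) (x e : V) :
  (\forall y \near x, differentiable f y) -> differentiable ('D_e f) x.
Proof.
move=> fn; have [->|e0] := eqVneq e 0.
  have -> : 'D_0 f = cst 0 by apply/funext => y; rewrite derive0.
  exact: differentiable_cst.
have [rho [M [rho0 M0 fd fM]]] := local_bound fn.
by have [] := derive_differentiable rho0 M0 fd fM e0.
Qed.

(** Cauchy's formula for the derivative of f along h expresses its derivative
   along e by the integral that gives the derivative along h of the derivative
   along e. *)
Lemma holo_derive_comm (V : normedModType C) (f : V -> C) (x e h : V) :
  (\forall y \near x, differentiable f y) ->
  'D_h ('D_e f) x = 'D_e ('D_h f) x.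
Proof.
move=> fn.
have h0 : 'D_0 f = cst 0 by apply/funext => y; rewrite derive0.
have [->|e0] := eqVneq e 0.
  transitivity ('D_h (cst (0 : C) : V -> C) x); first by congr (derive _ x h); exact: h0.
  by rewrite derive_cst [RHS]derive0.
have [rho [M [rho0 M0 fd fM]]] := local_bound fn.
have [dDe dE] := derive_differentiable rho0 M0 fd fM e0.
have De y : nrm (y - x) < 4 * rho -> differentiable ('D_h f) y.
  move=> yx; apply: holo_derive; apply/near_nrmP.
  exists (4 * rho - nrm (y - x)); first by rewrite subr_gt0.
  move=> z zy; apply: fd; rewrite (_ : z - x = (z - y) + (y - x)); last by rewrite addrA subrK.
  by apply: le_lt_trans (nrmD _ _) _; rewrite -ltrBrDr.
have ne0 : 0 < nrm e by rewrite nrm_gt0.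
have r0 : 0 < rho / nrm e by rewrite divr_gt0.
have cin y : nrm (y - x) <= rho / nrm e * nrm e -> nrm (y - x) < 4 * rho.
  by rewrite divfK ?gt_eqF// => yx; have := rho0; lra.
have [_ E] := circle_diff r0 (fun y h => De y (cin y h)).
have x4 : nrm (x - x) < 4 * rho by rewrite subrr nrm0; have := rho0; lra.
have c0 : (rho / nrm e * P)%:C != 0 :> C.
  by rewrite -nrm_gt0 nrmR normr_gt0 mulf_neq0 ?gt_eqF ?P_gt0.
apply: etrans (deriveE h dDe) _; apply: etrans (dE h) _.
apply/esym; apply: etrans (deriveE e (De x x4)) _; apply: (mulfI c0).
apply: etrans (esym E) _; apply/esym; apply: etrans (deriv_opE _ _ _ _ _) _ => //; apply/esym.
congr circ_int; apply/funext => t; rewrite deriveE//; apply: fd; apply: cin.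
by rewrite (addrC x) addrK nrmZ nrmM nrm_circ mulr1 nrmR gtr0_norm.
Qed.

End Cauchy.

(** * Calculus of partial derivatives *)

(** What the rest of the proof uses of complex analysis. *)
Definition smooth_field (K : numFieldType) : Prop :=
  (forall (V : normedModType K) (f : V -> K) (x e : V),
     (\forall y \near x, differentiable f y) -> differentiable ('D_e f) x) /\
  (forall (V : normedModType K) (f : V -> K) (x e h : V),
     (\forall y \near x, differentiable f y) ->
     'D_h ('D_e f) x = 'D_e ('D_h f) x).

Lemma complex_smooth (R : realType) : smooth_field R[i].
Proof. by split=> [V f x e|V f x e h]; [exact: holo_derive|exact: holo_derive_comm]. Qed.

Lemma near_openP (T : topologicalType) (m : T) (P : T -> Prop) :
  (\forall x \near m, P x) -> exists N : set T, [/\ open N, N m & forall x, N x -> P x].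
Proof.
move=> Pm; exists (interior [set x | P x]); split.
- exact: open_interior.
- exact: Pm.
- exact: interior_subset.
Qed.


Section HolomorphicCalculus.
Context {K : numFieldType} (hK : smooth_field K) {n : nat}.
Local Notation V := 'rV[K]_n.
Implicit Types (f g : V -> K) (x m : V) (N : set V) (s t : seq 'I_n) (l : 'I_n).

Lemma near_holo (W : normedModType K) (M : set W) (f : W -> K) (x : W) :
  open M -> holo_on M f -> M x -> \forall y \near x, differentiable f y.
Proof. by move=> oM fM Mx; apply: filterS (open_nbhs_nbhs (conj oM Mx)) => y /fM. Qed.

Lemma holo_pd N f l : open N -> holo_on N f -> holo_on N (pd l f).
Proof. by move=> oN fN x Nx; apply: hK.1; exact: near_holo Nx. Qed.

Lemma holo_pd_word N f s : open N -> holo_on N f -> holo_on N (pd_word s f).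
Proof. by move=> oN fN; elim: s => //= l s IH; exact: holo_pd. Qed.

Lemma eq_pd N f g l : open N -> (forall x, N x -> f x = g x) ->
  forall x, N x -> pd l f x = pd l g x.
Proof.
move=> oN fg x Nx; apply: near_eq_derive.
by apply: filterS (open_nbhs_nbhs (conj oN Nx)) => y /fg.
Qed.

Lemma eq_pd_word N f g s : open N -> (forall x, N x -> f x = g x) ->
  forall x, N x -> pd_word s f x = pd_word s g x.
Proof. by move=> oN fg; elim: s => //= l s IH; exact: eq_pd. Qed.

Lemma pd_comm N f l l' : open N -> holo_on N f ->
  forall x, N x -> pd l (pd l' f) x = pd l' (pd l f) x.
Proof. by move=> oN fN x Nx; apply: hK.2; exact: near_holo Nx. Qed.

Lemma pd_word_swap N f s l : open N -> holo_on N f ->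
  forall x, N x -> pd_word (rcons s l) f x = pd_word (l :: s) f x.
Proof.
move=> oN fN; elim: s => //= l' s IH x Nx.
apply: etrans (eq_pd l' oN IH Nx) _.
exact: (pd_comm l' l oN (holo_pd_word s oN fN) Nx).
Qed.

Lemma pd_word_cat s t f : pd_word (s ++ t) f = pd_word s (pd_word t f).
Proof. exact: foldr_cat. Qed.

Lemma pd_word_rcons s l f : pd_word (rcons s l) f = pd_word s (pd l f).
Proof. exact: foldr_rcons. Qed.

(** Induction on s: the first letter of s is moved to its place in t. *)
Lemma pd_word_perm N f s t : open N -> holo_on N f -> perm_eq s t ->
  forall x, N x -> pd_word s f x = pd_word t f x.
Proof.
move=> oN fN; elim: s t => [|l s IH] t st x Nx.
  by move: st; rewrite perm_sym => /perm_nilP->.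
have lt : l \in t by rewrite -(perm_mem st) mem_head.
move: st; case/splitPr: lt => t1 t2 st.
have {}st : perm_eq s (t1 ++ t2).
  by rewrite -(perm_cons l) (perm_trans st)// -cat_rcons -cats1 -catA perm_catCA.
have E y : N y -> pd_word s f y = pd_word t1 (pd_word t2 f) y.
  by move=> Ny; rewrite -pd_word_cat; exact: IH.
rewrite -cat_rcons pd_word_cat.
by rewrite (pd_word_swap t1 l oN (holo_pd_word t2 oN fN) Nx) /=; exact: (eq_pd l oN E).
Qed.

Lemma holoD N f g : holo_on N f -> holo_on N g -> holo_on N (fun x => f x + g x).
Proof. by move=> fN gN x Nx; apply: differentiableD; [exact: fN|exact: gN]. Qed.

Lemma holoM N f g : holo_on N f -> holo_on N g -> holo_on N (fun x => f x * g x).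
Proof. by move=> fN gN x Nx; apply: differentiableM; [exact: fN|exact: gN]. Qed.

Lemma holo_cst N (a : K) : holo_on N (fun _ : V => a).
Proof. by move=> x _; exact: differentiable_cst. Qed.

Lemma holoN N f : holo_on N f -> holo_on N (fun x => - f x).
Proof. by move=> fN x Nx; apply: differentiableN; exact: fN. Qed.

Lemma holoB N f g : holo_on N f -> holo_on N g -> holo_on N (fun x => f x - g x).
Proof. by move=> fN gN; apply: holoD => //; exact: holoN. Qed.

Lemma holoV N f : holo_on N f -> (forall x, N x -> f x != 0) ->
  holo_on N (fun x => (f x)^-1).
Proof. by move=> fN f0 x Nx; apply: differentiableV; [exact: fN|exact: f0]. Qed.

Lemma holo_sum N (I : Type) (r : seq I) (P : pred I) (F : I -> V -> K) :
  (forall i, P i -> holo_on N (F i)) -> holo_on N (fun x => \sum_(i <- r | P i) F i x).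
Proof.
move=> FN; elim: r => [|i r IH].
  by under eq_fun do rewrite big_nil; exact: holo_cst.
under eq_fun do rewrite big_cons.
case Pi: (P i); last exact: IH.
have Fi := FN i Pi.
exact: holoD.
Qed.

Lemma holo_prod N (I : Type) (r : seq I) (P : pred I) (F : I -> V -> K) :
  (forall i, P i -> holo_on N (F i)) -> holo_on N (fun x => \prod_(i <- r | P i) F i x).
Proof.
move=> FN; elim: r => [|i r IH].
  by under eq_fun do rewrite big_nil; exact: holo_cst.
under eq_fun do rewrite big_cons.
case Pi: (P i); last exact: IH.
have Fi := FN i Pi.
exact: holoM.
Qed.

Lemma pdD N f g l x : holo_on N f -> holo_on N g -> N x ->
  pd l (fun y => f y + g y) x = pd l f x + pd l g x.
Proof.
by move=> fN gN Nx; apply: deriveD; apply: diff_derivable; [exact: fN|exact: gN].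
Qed.

Lemma pdB N f g l x : holo_on N f -> holo_on N g -> N x ->
  pd l (fun y => f y - g y) x = pd l f x - pd l g x.
Proof.
by move=> fN gN Nx; apply: deriveB; apply: diff_derivable; [exact: fN|exact: gN].
Qed.

Lemma pdN N f l x : holo_on N f -> N x -> pd l (fun y => - f y) x = - pd l f x.
Proof. by move=> fN Nx; apply: deriveN; apply: diff_derivable; exact: fN. Qed.

Lemma pd_cst (a : K) l x : pd l (fun=> a) x = 0.
Proof. exact: derive_cst. Qed.

Lemma pdM N f g l x : holo_on N f -> holo_on N g -> N x ->
  pd l (fun y => f y * g y) x = pd l f x * g x + f x * pd l g x.
Proof.
move=> fN gN Nx; rewrite /pd (deriveM (f := f) (g := g)); last 2 first.
- by apply: diff_derivable; exact: fN.
- by apply: diff_derivable; exact: gN.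
by rewrite addrC mulrC.
Qed.

Lemma pd_sum N (I : Type) (r : seq I) (P : pred I) (F : I -> V -> K) l x :
  (forall i, P i -> holo_on N (F i)) -> N x ->
  pd l (fun y => \sum_(i <- r | P i) F i y) x = \sum_(i <- r | P i) pd l (F i) x.
Proof.
move=> FN Nx; elim: r => [|i r IH].
  by under eq_fun do rewrite big_nil; rewrite big_nil pd_cst.
under eq_fun do rewrite big_cons.
rewrite big_cons; case Pi: (P i) => //.
by rewrite (@pdD N) ?IH//; [exact: FN|exact: holo_sum].
Qed.

Lemma pd_wordD N f g s : open N -> holo_on N f -> holo_on N g -> forall x, N x ->
  pd_word s (fun y => f y + g y) x = pd_word s f x + pd_word s g x.
Proof.
move=> oN fN gN; elim: s => //= l s IH x Nx.
apply: etrans (eq_pd l oN IH Nx) _.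
by apply: (@pdD N) => //; exact: holo_pd_word.
Qed.

Lemma pd_wordN N f s : open N -> holo_on N f -> forall x, N x ->
  pd_word s (fun y => - f y) x = - pd_word s f x.
Proof.
move=> oN fN; elim: s => //= l s IH x Nx.
apply: etrans (eq_pd l oN IH Nx) _.
by apply: (@pdN N) => //; exact: holo_pd_word.
Qed.

Lemma pd_word_cst s (x : V) : pd_word s (fun=> 0 : K) x = 0.
Proof.
elim: s x => //= l s IH x.
have -> : pd_word s (fun=> 0 : K) = fun=> 0 by apply/funext.
exact: pd_cst.
Qed.

Lemma pd_word_sum N (I : Type) (r : seq I) (P : pred I) (F : I -> V -> K) s :
  open N -> (forall i, P i -> holo_on N (F i)) -> forall x, N x ->
  pd_word s (fun y => \sum_(i <- r | P i) F i y) x = \sum_(i <- r | P i) pd_word s (F i) x.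
Proof.
move=> oN FN; elim: r => [|i r IH] x Nx.
  by under eq_fun do rewrite big_nil; rewrite big_nil pd_word_cst.
under eq_fun do rewrite big_cons.
rewrite big_cons; case Pi: (P i); last exact: IH.
by rewrite (@pd_wordD N) ?IH//; [exact: FN|exact: holo_sum].
Qed.

End HolomorphicCalculus.

(** * The coefficients of pulled back forms *)

Local Notation coefC := Defs.coefC.

Section Pullback.
Context {K : numFieldType} (hK : smooth_field K) {n : nat}.
Local Notation V := 'rV[K]_n.
Implicit Types (f : V -> K) (x m : V) (N : set V) (s t : seq 'I_n) (l : 'I_n).
Implicit Types (g : K -> K) (O : set K).

Lemma holo_derive1 O g : open O -> holo_on O g -> holo_on O (derive1 g).
Proof.
move=> oO gO z Oz.
have -> : derive1 g = 'D_1 g by apply/funext => w; rewrite derive1E.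
by apply: hK.1; exact: near_holo Oz.
Qed.

Lemma holo_derive1n O g k : open O -> holo_on O g -> holo_on O (derive1n k g).
Proof.
move=> oO gO; elim: k => [|k IH]; first by rewrite derive1n0.
by rewrite derive1nS; exact: holo_derive1.
Qed.

Lemma holo_comp N O f g : holo_on N f -> holo_on O g -> (forall x, N x -> O (f x)) ->
  holo_on N (fun x => g (f x)).
Proof.
move=> fN gO NO x Nx.
exact: (@differentiable_comp _ _ _ _ f g x (fN x Nx) (gO _ (NO x Nx))).
Qed.

Lemma pd_comp N O f g l x : holo_on N f -> holo_on O g -> N x -> O (f x) ->
  pd l (fun y => g (f y)) x = derive1 g (f x) * pd l f x.
Proof.
move=> fN gO Nx Ofx; have dfx := fN x Nx; have dg := gO _ Ofx.
have dgf := differentiable_comp dfx dg.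
rewrite /pd (deriveE _ dgf) (deriveE _ dfx).
rewrite (diff_comp dfx dg) /= (derive1E' dg).
move: ('d f x _) => c; have cE : c *: (1 : K) = c by exact: mulr1.
by rewrite -{1}cE linearZ; exact: mulrC.
Qed.

Lemma coefC_cons f mu s h x : s != [::] -> (h <= size s)%N ->
  coefC f (mu :: s) h x =
    (if (h < size s)%N then pd mu (coefC f s h) x else 0) +
    (if (0 < h)%N then coefC f s h.-1 x * pd mu f x else 0).
Proof.
case: s => [//|l s] _ hs; rewrite /coefC -/(coefC f (l :: s)).
case: h hs => [|h] hs /=; first by rewrite addr0.
case: ltnP => // hs'; rewrite add0r.
have e : h.+1 == (size s).+1 by rewrite eqn_leq; apply/andP; split; [exact: hs|exact: hs'].
by rewrite e.
Qed.

Lemma coefC_big f s h x : (size s <= h)%N -> coefC f s h x = 0.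
Proof.
case: s => [//|l [|l' s]] /=; first by case: h.
case: h => [//|h] /= hs; rewrite ltnNge (ltnW hs) /=.
by rewrite gtn_eqF.
Qed.

Lemma holo_coefC N f s h : open N -> holo_on N f -> holo_on N (coefC f s h).
Proof.
move=> oN fN; elim: s h => [|mu s IH] h /=; first exact: holo_cst.
case: s IH => [|l s] IH; first by case: h => [|h]; [exact: holo_pd|exact: holo_cst].
case: h => [|h]; first exact: (holo_pd hK mu oN (IH 0%N)).
have hd := holo_pd hK mu oN (IH h.+1); have hp := holo_pd hK mu oN fN.
have hm := holoM (IH h) hp.
case E: (h.+1 < size (l :: s))%N; first exact: holoD hd hm.
by case F: (h.+1 == size (l :: s)); [exact: hm|exact: holo_cst].
Qed.

(** The coefficients C^h_L are those of the iterated derivatives of a pulled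
   back form: the chain and product rules give the recursion that defines
   them. *)
Lemma pd_word_pullback N O f g s l : open N -> holo_on N f -> open O -> holo_on O g ->
  (forall x, N x -> O (f x)) -> forall x, N x ->
  pd_word s (fun y => g (f y) * pd l f y) x =
  \sum_(h < (size s).+1) coefC f (rcons s l) h x * derive1n h g (f x).
Proof.
move=> oN fN oO gO NO; elim: s => [|mu s IH] x Nx.
  by rewrite big_ord1 derive1n0 mulrC.
pose t := rcons s l; have t0 : t != [::] by rewrite /t; case: (s).
have st : size t = (size s).+1 by rewrite size_rcons.
have hc h := holo_coefC t h oN fN.
have hg h := holo_comp fN (holo_derive1n h oO gO) NO.
apply: etrans (eq_pd mu oN IH Nx) _.
rewrite -/t (pd_sum _ (N := N))//; last by move=> h _; exact: holoM.
change (rcons (mu :: s) l) with (mu :: t); change (size (mu :: s)) with (size s).+1.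
rewrite [RHS](eq_bigr (fun h : 'I_(size s).+2 =>
   (if (h < size t)%N then pd mu (coefC f t h) x * derive1n h g (f x) else 0) +
    (if (0 < h)%N then coefC f t h.-1 x * pd mu f x * derive1n h g (f x) else 0))); last first.
  move=> h _; rewrite coefC_cons//; last by rewrite st -ltnS.
  by rewrite mulrDl; congr (_ + _); case: ifP => // _; rewrite mul0r.
rewrite big_split /= [X in _ = X + _]big_ord_recr [X in _ = _ + X]big_ord_recl /=.
rewrite st ltnn addr0 add0r -big_split /=; apply: eq_bigr => h _.
rewrite (pdM _ (hc h) (hg h) Nx) ltn_ord; congr (_ + _).
rewrite (pd_comp _ fN (holo_derive1n h oO gO) Nx (NO x Nx)).
by rewrite add0n mulrA mulrAC.
Qed.

(** The polynomial with prescribed derivatives c 0, ..., c k at z0. *)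
Definition tay (c : nat -> K) (k : nat) (z0 z : K) : K :=
  \sum_(h < k.+1) c h / (h`!)%:R * (z - z0) ^+ h.

Lemma tay_at c k z0 : tay c k z0 z0 = c 0%N.
Proof.
rewrite /tay big_ord_recl /= subrr expr0 fact0 divr1 mulr1 big1 ?addr0// => h _.
by rewrite expr0n /= mulr0.
Qed.

Lemma is_derive_tay c k z0 (z : K) :
  is_derive z 1 (tay c k.+1 z0) (tay (fun h => c h.+1) k z0 z).
Proof.
have -> : tay c k.+1 z0 =
    \sum_(h < k.+2) (fun y : K => (c h / (h`!)%:R) *: (y - z0) ^+ h).
  by apply/funext => y; rewrite fct_sumE.
have dX (h : 'I_k.+2) : is_derive z 1 (fun y : K => (c h / (h`!)%:R) *: (y - z0) ^+ h)
    ((c h / (h`!)%:R) * (h%:R * (z - z0) ^+ h.-1)).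
  have dz : is_derive z 1 (fun y : K => y - z0) 1.
    by apply: is_derive_eq; rewrite subr0.
  have := is_deriveZ (c h / (h`!)%:R) (is_deriveX h dz).
  have -> : (fun y => y - z0) ^+ h = fun y => (y - z0) ^+ h.
    by apply/funext => y; rewrite exprfctE.
  by rewrite /GRing.scale /= mulr1.
apply: is_derive_eq; rewrite /tay big_ord_recl /= mul0r mulr0 add0r.
apply: eq_bigr => h _; rewrite /bump /= add0n factS natrM mulrA; congr (_ * _).
by rewrite add1n invfM -!mulrA; congr (_ * _); rewrite mulrCA mulVf ?mulr1// pnatr_eq0.
Qed.

Lemma derive1_tay c k z0 : derive1 (tay c k.+1 z0) = tay (fun h => c h.+1) k z0.
Proof.
apply/funext => z; rewrite derive1E; have [_] := is_derive_tay c k z0 z.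
by [].
Qed.

Lemma derive1n_tay c d k z0 : (k <= d)%N ->
  derive1n k (tay c d z0) = tay (fun h => c (h + k)%N) (d - k) z0.
Proof.
elim: k c d => [|k IH] c d kd.
  by rewrite derive1n0 subn0; congr tay; apply/funext => h; rewrite addn0.
rewrite derive1nS IH; last exact: ltnW.
case: d kd => // d kd; rewrite subSS subSn// derive1_tay.
by congr tay; apply/funext => h; rewrite addnS addSn.
Qed.

Lemma derive1n_tay_at c d k z0 : (k <= d)%N -> derive1n k (tay c d z0) z0 = c k.
Proof. by move=> kd; rewrite derive1n_tay// tay_at. Qed.

Lemma tay_differentiable c k z0 (z : K) : differentiable (tay c k z0) z.
Proof.
apply/derivable1_diffP; case: k => [|k].
  have -> : tay c 0 z0 = cst (c 0%N).
    by apply/funext => y; rewrite /tay big_ord1 expr0 fact0 divr1 mulr1.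
  exact: derivable_cst.
by have [] := is_derive_tay c k z0 z.
Qed.

Lemma tay_holo c k z0 O : holo_on O (tay c k z0).
Proof. by move=> z _; exact: tay_differentiable. Qed.

(** [pd_word_pullback] for (z - f x)^h / h!, the derivative of the polynomial
   below: among its own derivatives at f x only the h-th one is not 0. *)
Lemma coefC_pd N f t h x : open N -> holo_on N f -> t != [::] -> N x ->
  coefC f t h x =
  pd_word t (fun y => tay (fun j => (j == h.+1)%:R) (size t).+1 (f x) (f y)) x.
Proof.
move=> oN fN; case/lastP: t => [//|s l] _ Nx; rewrite size_rcons.
set G := tay _ _ _; rewrite pd_word_rcons.
pose g := tay (fun j => (j == h)%:R) (size s).+1 (f x).
have E y : N y -> pd l (fun y => G (f y)) y = g (f y) * pd l f y.
  move=> Ny; rewrite (@pd_comp N setT)//; last exact: tay_holo.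
  by rewrite /G derive1_tay; congr (tay _ _ _ _ * _); apply/funext => j; rewrite eqSS.
apply/esym; apply: etrans (eq_pd_word s oN E Nx) _.
rewrite (@pd_word_pullback N setT)//; [|exact: openT|exact: tay_holo].
have [hs|hs] := ltnP h (size s).+1; last first.
  rewrite coefC_big ?size_rcons// big1// => k _.
  rewrite derive1n_tay_at; last by rewrite ltnW// ltn_ord.
  by rewrite ltn_eqF ?mulr0// (leq_trans (ltn_ord k)).
rewrite (bigD1 (Ordinal hs))//= big1 ?addr0.
  by rewrite derive1n_tay_at ?eqxx ?mulr1// ltnW.
move=> k kh; rewrite derive1n_tay_at; last by rewrite ltnW// ltn_ord.
rewrite (_ : (k == h :> nat) = false) ?mulr0//.
by apply: contra_neqF kh => /eqP kh; apply/val_inj.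
Qed.

(** By [coefC_pd] this is the symmetry of iterated partial derivatives. *)
Lemma coefC_perm N f t t' h x : open N -> holo_on N f -> perm_eq t t' -> N x ->
  coefC f t h x = coefC f t' h x.
Proof.
move=> oN fN tt' Nx; have [t0|t0] := eqVneq t [::].
  by move: tt'; rewrite t0 perm_sym => /perm_nilP->.
have t0' : t' != [::].
  by apply: contra_neq t0 => t'0; move: tt'; rewrite t'0 => /perm_nilP.
rewrite (coefC_pd h oN fN t0 Nx) (coefC_pd h oN fN t0' Nx) (perm_size tt').
apply: (pd_word_perm hK oN) => //.
by apply: (@holo_comp N setT) => //; exact: tay_holo.
Qed.

Lemma coefC_top f t x : t != [::] ->
  coefC f t (size t).-1 x = \prod_(l <- t) pd l f x.
Proof.
elim: t => [//|mu [|l s] IH] _; first by rewrite big_seq1.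
rewrite coefC_cons// big_cons /= ltnn add0r -/(coefC f (l :: s)) mulrC.
by congr (_ * _); exact: IH.
Qed.

End Pullback.

(** * Vanishing of jets *)

(* Terms such as pd p a x and pd q a x are compared often below; unfolding them
   to limits of difference quotients would be of no use. *)
Opaque pd.

Section Vanishing.
Context {K : numFieldType} (hK : smooth_field K) {n : nat}.
Local Notation V := 'rV[K]_n.
Implicit Types (f g a b : V -> K) (x m : V) (N : set V) (s t : seq 'I_n) (l : 'I_n).

(** Vanishing of the k-jet at m. *)
Definition van (k : nat) (m : V) (f : V -> K) : Prop :=
  forall s, (size s <= k)%N -> pd_word s f m = 0.

Lemma van_le k k' m f : (k' <= k)%N -> van k m f -> van k' m f.
Proof. by move=> kk' h s sk; apply: h; exact: leq_trans kk'. Qed.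

Lemma van_pd k m f l : van k.+1 m f -> van k m (pd l f).
Proof. by move=> h s sk; rewrite -pd_word_rcons; apply: h; rewrite size_rcons. Qed.

Lemma vanS k m f : f m = 0 -> (forall l, van k m (pd l f)) -> van k.+1 m f.
Proof.
move=> f0 h s; case/lastP: s => [//|s l]; rewrite size_rcons => sk.
by rewrite pd_word_rcons; exact: h.
Qed.

Section OnOpen.
Variables (N : set V) (m : V).
Hypotheses (oN : open N) (Nm : N m).

Lemma van_eq k f g : (forall x, N x -> f x = g x) -> van k m f -> van k m g.
Proof. by move=> fg h s sk; rewrite -(eq_pd_word s oN fg Nm); exact: h. Qed.

Lemma vanD k f g : holo_on N f -> holo_on N g -> van k m f -> van k m g ->
  van k m (fun x => f x + g x).
Proof.
move=> fN gN hf hg s sk.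
by rewrite (pd_wordD hK s oN fN gN Nm) hf// hg// addr0.
Qed.

Lemma vanN k f : holo_on N f -> van k m f -> van k m (fun x => - f x).
Proof. by move=> fN hf s sk; rewrite (pd_wordN hK s oN fN Nm) hf// oppr0. Qed.

Lemma vanB k f g : holo_on N f -> holo_on N g -> van k m f -> van k m g ->
  van k m (fun x => f x - g x).
Proof. by move=> fN gN hf hg; apply: vanD => //; [exact: holoN|exact: vanN]. Qed.

Lemma van_sum k (I : Type) (r : seq I) (P : pred I) (F : I -> V -> K) :
  (forall i, P i -> holo_on N (F i)) -> (forall i, P i -> van k m (F i)) ->
  van k m (fun x => \sum_(i <- r | P i) F i x).
Proof.
move=> FN hF s sk; rewrite (pd_word_sum hK r s oN FN Nm).
by rewrite big1// => i Pi; exact: hF.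
Qed.

(** Leibniz rule: functions vanishing to order k at m form an ideal. *)
Lemma vanM k f g : holo_on N f -> holo_on N g -> van k m f ->
  van k m (fun x => f x * g x).
Proof.
elim: k f g => [|k IH] f g fN gN hf.
  by move=> [|//] _ /=; have /= -> := hf [::] isT; rewrite mul0r.
apply: vanS => [|l]; first by have /= -> := hf [::] isT; rewrite mul0r.
have fl := holo_pd hK l oN fN; have gl := holo_pd hK l oN gN.
apply: (@van_eq _ (fun x => pd l f x * g x + f x * pd l g x)).
  by move=> x Nx; rewrite (pdM l fN gN Nx).
apply: vanD; [exact: holoM|exact: holoM| |].
  by apply: IH => //; exact: van_pd.
by apply: IH => //; exact: van_le hf.
Qed.

(** A function whose differential is proportional to that of f up to order
   k - 1 agrees to order k with a function of f. Dividing d a by d f gives a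
   function with the same property one order lower, and a primitive of the
   function of one variable found for it suits a. *)
Lemma wedge_van k f a l0 : holo_on N f -> holo_on N a ->
  (forall x, N x -> pd l0 f x != 0) ->
  (forall k', k = k'.+1 -> forall p q,
     van k' m (fun x => pd p a x * pd q f x - pd q a x * pd p f x)) ->
  exists c : nat -> K, van k m (fun x => a x - tay c k (f m) (f x)).
Proof.
move=> fN; elim: k a => [|k IH] a aN f0 wa.
  exists (fun=> a m) => -[|//] _ /=; rewrite tay_at subrr //.
have fl := holo_pd hK l0 oN fN; have al := holo_pd hK l0 oN aN.
have iN := holoV fl f0.
(* da = b df up to the forms r, which vanish to order k *)
pose b x := pd l0 a x * (pd l0 f x)^-1.
have bN : holo_on N b by exact: holoM.
pose r p x := pd p a x - b x * pd p f x.
have rN p : holo_on N (r p).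
  by apply: holoB; [exact: holo_pd|apply: holoM => //; exact: holo_pd].
have rv p : van k m (r p).
  apply: (@van_eq _ (fun x => (pd p a x * pd l0 f x - pd l0 a x * pd p f x) * (pd l0 f x)^-1)).
    by move=> x Nx; rewrite /r /b; field; exact: f0.
  apply: vanM => //; last exact: wa.
  by apply: holoB; apply: holoM => //; exact: holo_pd.
have [|c hc] := IH b bN f0.
  move=> k' kk' p q.
  have rpv : van k' m (pd q (r p)) by apply: van_pd; rewrite -kk'.
  have rqv : van k' m (pd p (r q)) by apply: van_pd; rewrite -kk'.
  (* the exterior derivative of da - b df is - db /\ df *)
  apply: (@van_eq _ (fun x => pd q (r p) x - pd p (r q) x)); last first.
    by apply: vanB => //; exact: holo_pd.
  move=> x Nx; have rE p' q' : pd q' (r p') x = pd q' (pd p' a) x -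
      (pd q' b x * pd p' f x + b x * pd q' (pd p' f) x).
    have ap := holo_pd hK p' oN aN; have fp := holo_pd hK p' oN fN.
    by rewrite /r (pdB q' ap (holoM bN fp) Nx) (pdM q' bN fp Nx).
  rewrite (rE p q) (rE q p) (pd_comm hK q p oN aN Nx) (pd_comm hK q p oN fN Nx).
  move: (pd p (pd q a) x) (pd p (pd q f) x) (pd p b x) (pd q b x) (pd p f x) (pd q f x) (b x).
  by move=> *; ring.
exists (fun h => if h is h'.+1 then c h' else a m).
set G := tay _ _ _; have GN : holo_on N (fun x => G (f x)).
  by apply: (@holo_comp _ _ N setT) => //; exact: tay_holo.
have gN : holo_on N (fun x => tay c k (f m) (f x)).
  by apply: (@holo_comp _ _ N setT) => //; exact: tay_holo.
apply: vanS => [|l]; first by rewrite /G tay_at subrr.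
have fl' := holo_pd hK l oN fN.
apply: (@van_eq _ (fun x => r l x + (b x - tay c k (f m) (f x)) * pd l f x)); last first.
  apply: vanD => //; first by apply: holoM => //; exact: holoB.
  by apply: vanM => //; exact: holoB.
move=> x Nx; rewrite (pdB l aN GN Nx) (@pd_comp _ _ N setT)//; last exact: tay_holo.
by rewrite /G derive1_tay /r; ring.
Qed.

End OnOpen.

End Vanishing.

(** * Multi-indices as words *)

Section MultiIndices.
Context {n : nat}.

Lemma count_mword (L : 'I_n -> nat) l : count_mem l (mword L) = L l.
Proof.
rewrite /mword count_flatten -map_comp.
rewrite (eq_map (g := fun l' => (l' == l) * L l')%N); last first.
  by move=> l' /=; rewrite count_nseq.
rewrite sumnE big_map big_enum /= (bigD1 l)//= eqxx mul1n big1 ?addn0//.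
by move=> l' /negbTE ->.
Qed.

Lemma size_mword (L : 'I_n -> nat) : size (mword L) = (\sum_l L l)%N.
Proof.
rewrite /mword size_flatten /shape -map_comp sumnE big_map big_enum /=.
by apply: eq_bigr => l _; rewrite size_nseq.
Qed.

Lemma sum_count (s : seq 'I_n) : (\sum_l count_mem l s)%N = size s.
Proof.
elim: s => [|l s IH] /=; first by rewrite big1.
by rewrite big_split /= IH (bigD1 l)//= eqxx big1 ?addn0// => l' /negbTE; rewrite eq_sym => ->.
Qed.

Lemma midx_le_wordP (k : nat) (s : seq 'I_n) : (size s <= k)%N ->
  exists L : midx_le n k, perm_eq (midx_le_word L) s.
Proof.
move=> sk; pose L := [ffun l => inord (count_mem l s) : 'I_k.+1].
have LE l : L l = count_mem l s :> nat.
  by rewrite ffunE inordK// ltnS (leq_trans (count_size _ _)).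
have LP : (\sum_l L l <= k)%N by under eq_bigr do rewrite LE; rewrite sum_count.
exists (exist _ L LP); apply/allP => l _; apply/eqP.
by rewrite /midx_le_word count_mword LE.
Qed.

Lemma size_midx_le_word (k : nat) (L : midx_le n k) : (size (midx_le_word L) <= k)%N.
Proof. by rewrite size_mword; exact: (valP L). Qed.

Lemma midx_wordP (j : nat) (s : seq 'I_n) : size s = j ->
  exists L : midx n j, perm_eq (midx_word L) s.
Proof.
move=> sj; pose L := [ffun l => inord (count_mem l s) : 'I_j.+1].
have LE l : L l = count_mem l s :> nat.
  by rewrite ffunE inordK// ltnS -sj count_size.
have LP : (\sum_l L l == j)%N by under eq_bigr do rewrite LE; rewrite sum_count sj.
exists (exist _ L LP); apply/allP => l _; apply/eqP.
by rewrite /midx_word count_mword LE.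
Qed.

Lemma size_midx_word (j : nat) (L : midx n j) : size (midx_word L) = j.
Proof. by rewrite size_mword; exact/eqP/(valP L). Qed.

Lemma midx_le_word_widen (k : nat) (L : midx_le n k) :
  midx_le_word (midx_le_widen L) = midx_le_word L.
Proof.
rewrite /midx_le_word /mword; congr flatten; apply: eq_map => l.
by rewrite /midx_le_widen /= ffunE.
Qed.

End MultiIndices.

(** * The map Phi *)

Section PhiMap.
Context {K : numFieldType} (hK : smooth_field K) {n d : nat}.
Local Notation V := 'rV[K]_n.
Variables (U : set V) (u : 'I_d -> V -> K).
Hypotheses (oU : open U) (uU : forall i, holo_on U (u i)).
Hypothesis u0 : forall i x, U x -> dform (u i) x != 0.
Variable m : V.
Hypothesis Um : U m.
Implicit Types (k : nat) (s : seq 'I_n) (l : 'I_n) (i : 'I_d).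

Lemma comp1_pullback (g : 'I_d -> K -> K) i l x :
  comp1 (pullback_forms u g) (i, l) x = g i (u i x) * pd l (u i) x.
Proof. by rewrite /comp1 /pullback_forms /dform !mxE. Qed.

Lemma dform_neq0 i x : U x -> exists l, pd l (u i) x != 0.
Proof. by move=> /(u0 i)/rV0Pn[l]; rewrite mxE => ?; exists l. Qed.

(** Value at m of the partial derivatives of the components of the forms
   g_i(u_i) du_i, in terms of the derivatives w of the g_i. *)
Definition pull_jet k (w : 'cV[K]_(\sum_(h < k.+1) d)) i s l : K :=
  \sum_(h < k.+1) coefC (u i) (rcons s l) h m * submxcol w h i 0.

Lemma pd_word_has_derivatives k (w : 'cV[K]_(\sum_(h < k.+1) d)) g i l s :
  has_derivatives u m w g -> (size s <= k)%N ->
  pd_word s (comp1 (pullback_forms u g) (i, l)) m = pull_jet w i s l.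
Proof.
move=> /(_ i)[gd gw] sk.
have [W [oW Wm Wd]] := near_openP gd.
have uc : {for m, continuous (u i)} by apply: differentiable_continuous; exact: uU.
have [N [oN Nm NU]] : exists N, [/\ open N, N m & forall x, N x -> U x /\ W (u i x)].
  apply: near_openP; apply: filterI; first exact: open_nbhs_nbhs.
  by apply: uc; exact: open_nbhs_nbhs.
have fN : holo_on N (u i) by move=> x /NU[Ux _]; exact: uU.
have -> : comp1 (pullback_forms u g) (i, l) = fun x => g i (u i x) * pd l (u i) x.
  by apply/funext => x; rewrite comp1_pullback.
rewrite (pd_word_pullback hK s l oN fN oW Wd (fun x h => (NU x h).2) Nm).
rewrite (big_ord_widen k.+1 (fun h => coefC (u i) (rcons s l) h m * derive1n h (g i) (u i m)))//.
rewrite big_mkcond /=; apply: eq_bigr => h _; rewrite gw.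
case: ltnP => // hs; rewrite coefC_big ?mul0r// size_rcons.
exact: hs.
Qed.

Lemma taylor_polyE k (w : 'cV[K]_(\sum_(h < k.+1) d)) i :
  taylor_poly u m w i = tay (fun h => submxcol w (inord h) i 0) k (u i m).
Proof.
apply/funext => z; rewrite /taylor_poly /tay; apply: eq_bigr => h _.
by rewrite inord_val.
Qed.

Lemma has_derivatives_taylor k (w : 'cV[K]_(\sum_(h < k.+1) d)) :
  has_derivatives u m w (taylor_poly u m w).
Proof.
move=> i; rewrite taylor_polyE; split; first by near=> z; exact: tay_differentiable.
by move=> h; rewrite derive1n_tay_at ?inord_val// -ltnS.
Unshelve. all: by end_near. Qed.

Lemma PhiE k (w : 'cV[K]_(\sum_(h < k.+1) d)) t :
  Phi u m w t = pull_jet w t.1.1 (midx_le_word t.2) t.1.2.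
Proof.
case: t => [[i l] L]; rewrite /Phi /jet ffunE /=.
apply: pd_word_has_derivatives; first exact: has_derivatives_taylor.
exact: size_midx_le_word.
Qed.

Lemma jet_has_derivatives k (w : 'cV[K]_(\sum_(h < k.+1) d)) g :
  has_derivatives u m w g -> jet k m (comp1 (pullback_forms u g)) = Phi u m w.
Proof.
move=> gw; apply/ffunP => -[[i l] L]; rewrite PhiE /jet ffunE /=.
by apply: pd_word_has_derivatives => //; exact: size_midx_le_word.
Qed.

Lemma pull_jet_linear k i s l :
  linear (fun w : 'cV[K]_(\sum_(h < k.+1) d) => pull_jet w i s l : K^o).
Proof.
move=> a v w; rewrite /pull_jet scaler_sumr -big_split /=; apply: eq_bigr => h _.
by rewrite !mxE /GRing.scale/=; ring.
Qed.

Lemma Phi_linear k : linear (@Phi _ _ _ u k m).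
Proof.
move=> a v w; apply/ffunP => t.
have RE (p q : jets K n ('I_d * 'I_n)%type k) : (a *: p + q) t = a *: p t + q t.
  by rewrite !ffunE.
by rewrite RE !PhiE; exact: pull_jet_linear.
Qed.

Lemma pull_jet_perm k (w : 'cV[K]_(\sum_(h < k.+1) d)) i s l s' l' :
  perm_eq (rcons s l) (rcons s' l') -> pull_jet w i s l = pull_jet w i s' l'.
Proof.
by move=> ss; apply: eq_bigr => h _; rewrite (coefC_perm hK h oU (uU i) ss Um).
Qed.

Lemma perm_rcons2 s s' l : perm_eq s s' -> perm_eq (rcons s l) (rcons s' l).
Proof. by move=> ss; rewrite -!cats1 perm_cat2r. Qed.

(** The derivatives of order h along a direction l with nonzero partial
   derivative of u_i involve w^(0), ..., w^(h), the last one with coefficient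
   a power of that derivative: solve for them successively. *)
Lemma pull_jet0 k (w : 'cV[K]_(\sum_(h < k.+1) d)) :
  (forall i s l, (size s <= k)%N -> pull_jet w i s l = 0) -> w = 0.
Proof.
move=> w0; suff H h i : (h < k.+1)%N -> submxcol w (inord h) i 0 = 0.
  rewrite -[w]submxcolK; apply/matrixP => r c; rewrite !mxE.
  have := H (tagnat.sig1 r) (tagnat.sig2 r) (ltn_ord _); rewrite inord_val mxE => H'.
  by rewrite ord1.
elim/ltn_ind: h => h IH hk; have [l l0] := dform_neq0 i Um.
have := w0 i (nseq h l) l; rewrite size_nseq => /(_ hk).
rewrite /pull_jet (bigD1 (Ordinal hk))//= big1 ?addr0.
  have -> : rcons (nseq h l) l = nseq h.+1 l.
    by elim: (h) => //= h' ->.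
  have := @coefC_top K n (u i) (nseq h.+1 l) m isT; rewrite [size _](size_nseq h.+1) => ->.
  have p0 : \prod_(l' <- nseq h.+1 l) pd l' (u i) m != 0.
    by rewrite big_nseq; elim: h.+1 => [|j IHj] /=; [exact: oner_neq0|exact: mulf_neq0].
  move/eqP; rewrite mulf_eq0 (negbTE p0) => /eqP.
  by rewrite (_ : inord h = Ordinal hk)//; apply/val_inj; rewrite /= inordK.
move=> h' hh'; have [h'h|h'h|h'h] := ltngtP h' h.
- by rewrite -[h' in submxcol w h']inord_val IH ?mulr0.
- by rewrite coefC_big ?mul0r// size_rcons size_nseq.
- by case/eqP: hh'; apply/val_inj.
Qed.

Lemma Phi_pull_jet k (v w : 'cV[K]_(\sum_(h < k.+1) d)) i s l :
  Phi u m v = Phi u m w -> (size s <= k)%N -> pull_jet v i s l = pull_jet w i s l.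
Proof.
move=> vw sk; have [L Ls] := midx_le_wordP sk.
have := congr1 (fun J : jets _ _ _ _ => J ((i, l), L)) vw; rewrite !PhiE /=.
by rewrite !(pull_jet_perm _ _ (perm_rcons2 l Ls)).
Qed.

Lemma Phi_inj k : injective (@Phi _ _ _ u k m).
Proof.
move=> v w vw; apply/eqP; rewrite -subr_eq0; apply/eqP; apply: pull_jet0 => i s l sk.
have := pull_jet_linear i s l (-1) w v.
rewrite !scaleN1r (addrC (- w)) => ->.
by rewrite (Phi_pull_jet i l vw sk) addNr.
Qed.

End PhiMap.

(** * Holomorphic matrices and independent differentials *)

Section LinearAlgebra.
Context {K : numFieldType} {n : nat}.
Local Notation V := 'rV[K]_n.

Lemma holo_det (N : set V) p (A : V -> 'M[K]_p) :
  (forall i j, holo_on N (fun x => A x i j)) -> holo_on N (fun x => \det (A x)).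
Proof.
move=> hA; rewrite /determinant; apply: holo_sum => s _; apply: holoM; first exact: holo_cst.
by apply: holo_prod => i _; exact: hA.
Qed.

Lemma holo_adj (N : set V) p (A : V -> 'M[K]_p) :
  (forall i j, holo_on N (fun x => A x i j)) ->
  forall i j, holo_on N (fun x => (\adj (A x)) i j).
Proof.
move=> hA i j; under eq_fun do rewrite mxE /cofactor.
apply: holoM; first exact: holo_cst.
apply: holo_det => i' j'; under eq_fun do rewrite !mxE; exact: hA.
Qed.

Lemma holo_invmx (N : set V) p (A : V -> 'M[K]_p) :
  (forall i j, holo_on N (fun x => A x i j)) -> (forall x, N x -> \det (A x) != 0) ->
  forall i j, holo_on N (fun x => ((\det (A x))^-1 *: \adj (A x)) i j).
Proof.
move=> hA dA i j; under eq_fun do rewrite mxE.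
by apply: holoM; [apply: holoV => //; exact: holo_det|exact: holo_adj].
Qed.

Lemma near_neq0 (N : set V) (f : V -> K) m : holo_on N f -> N m -> f m != 0 ->
  \forall x \near m, f x != 0.
Proof.
move=> fN Nm f0; have fc : {for m, continuous f} by apply: differentiable_continuous; exact: fN.
exact: cvgr_neq0 fc f0.
Qed.

Lemma holo_row (N : set V) (F : 'I_n -> V -> K) :
  (forall l, holo_on N (F l)) -> forall x, N x -> differentiable (fun x => \row_l F l x) x.
Proof.
move=> hF x Nx.
have -> : (fun x => \row_l F l x) = \sum_(l < n) (fun x : V => F l x *: (delta_mx 0 l : V)).
  apply/funext => y; rewrite fct_sumE [LHS]row_sum_delta; apply: eq_bigr => l _.
  by rewrite mxE.
apply: differentiable_sum => l; apply: differentiableZl; exact: hF.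
Qed.

Lemma holo_entry (N : set V) (s : V -> V) l :
  (forall x, N x -> differentiable s x) -> holo_on N (fun x => s x 0 l).
Proof.
move=> hs x Nx.
have dl := differentiable_coord (s x) 0 l.
exact: (@differentiable_comp _ _ _ _ s (fun v : V => v 0 l) x (hs x Nx) dl).
Qed.

Lemma in_Ai_scale (f : V -> K) x c : in_Ai f x (c *: dform f x).
Proof. by rewrite /in_Ai /tgt linearZ /= -scalemxAr mulmx_ker scaler0. Qed.

(** A form vanishing on the tangent space vanishes on the vector
   (d_p f) e_q - (d_q f) e_p. *)
Lemma in_Ai_wedge (f : V -> K) x (w : V) p q : in_Ai f x w ->
  pd p f x * w 0 q = pd q f x * w 0 p.
Proof.
rewrite /in_Ai /tgt => w0.
have E (r : 'I_n) (z : V) : (delta_mx 0 r : V) *m z^T = (z 0 r)%:M.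
  by rewrite -rowE; apply/matrixP => a b; rewrite !ord1 !mxE eqxx.
pose v : V := pd p f x *: delta_mx 0 q - pd q f x *: delta_mx 0 p.
have : (v <= kermx (dform f x)^T)%MS.
  apply/sub_kermxP; rewrite mulmxBl -!scalemxAl !E !mxE.
  by rewrite !scale_scalar_mx mulrC subrr.
move=> /submxP[D vE]; have : v *m w^T = 0 by rewrite vE -mulmxA w0 mulmx0.
rewrite mulmxBl -!scalemxAl !E !scale_scalar_mx => /matrixP/(_ 0 0).
by rewrite !mxE eqxx => /eqP; rewrite subr_eq0 => /eqP.
Qed.

(** The tangent spaces of n foliations in general position meet in 0 only, so
   the n differentials are independent. *)
Lemma general_position_unit d (u : 'I_d -> V -> K) x (S : {set 'I_d}) :
  (n <= #|S|)%N -> general_position u x S ->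
  exists e : 'I_n -> 'I_d, (\matrix_(j, l) pd l (u (e j)) x) \in unitmx.
Proof.
move=> nS gS; pose T := [set i in take n (enum S)].
have cT : #|T| = n.
  rewrite cardsE; have /card_uniqP -> : uniq (take n (enum S)) by rewrite take_uniq// enum_uniq.
  by rewrite size_takel// -cardE.
have TS : T \subset S.
  by apply/fintype.subsetP => i; rewrite inE => /mem_take; rewrite mem_enum.
have := gS T TS; rewrite cT leqnn => /(_ isT)/eqP.
rewrite -[X in _ == X]add0n eqn_add2r mxrank_eq0 => /eqP T0.
exists (fun j => enum_val (cast_ord (esym cT) j)).
set A := \matrix_(_, _) _; rewrite -unitmx_tr -row_free_unit; apply: inj_row_free => v vA.
apply/eqP; rewrite -submx0 -T0; apply/sub_bigcapmxP => i iT; apply/sub_kermxP.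
have jP : enum_val (cast_ord (esym cT) (cast_ord cT (enum_rank_in iT i))) = i.
  by rewrite cast_ord_comp cast_ord_id enum_rankK_in.
apply/matrixP => a b; move/matrixP/(_ a (cast_ord cT (enum_rank_in iT i))) : vA.
rewrite !mxE => H; rewrite -[RHS]H; apply: eq_bigr => l _.
by rewrite !mxE jP.
Qed.

End LinearAlgebra.

(** * Formal abelian relations as a kernel *)

Section FormalRelations.
Context {K : numFieldType} (hK : smooth_field K) {n d : nat}.
Local Notation V := 'rV[K]_n.
Variables (U : set V) (u : 'I_d -> V -> K).
Hypotheses (oU : open U) (uU : forall i, holo_on U (u i)).
Hypothesis u0 : forall i x, U x -> dform (u i) x != 0.
Variable m : V.
Hypothesis Um : U m.
Implicit Types (k : nat) (s : seq 'I_n) (l : 'I_n) (i : 'I_d).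

Lemma MbigP k (w : 'cV[K]_(\sum_(h < k.+1) d)) :
  Mbig u k.+1 m *m w = 0 <->
  forall (j : 'I_k.+1) (L : midx n j.+1),
    \sum_i \sum_(h < k.+1) coefC (u i) (midx_word L) h m * submxcol w h i 0 = 0.
Proof.
have E : Mbig u k.+1 m *m w =
    \mxcol_(j < k.+1) \sum_(h < k.+1) Mblock u j.+1 h m *m submxcol w h.
  by rewrite /Mbig -{1}[w]submxcolK mul_mxblock_mxrow.
have F (j : 'I_k.+1) (r : 'I_#|midx n j.+1|) c :
    (\sum_(h < k.+1) Mblock u j.+1 h m *m submxcol w h) r c =
    \sum_i \sum_(h < k.+1) coefC (u i) (midx_word (enum_val r)) h m * submxcol w h i 0.
  rewrite summxE exchange_big /=; apply: eq_bigr => h _; rewrite mxE.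
  by apply: eq_bigr => i _; rewrite [Mblock _ _ _ _ _ _]mxE ord1.
rewrite E; split=> [H j L|H].
  have := F j (enum_rank L) 0; rewrite enum_rankK => <-.
  have := congr1 (fun M => submxcol M j) H; rewrite mxcolK submxcol0 => ->.
  by rewrite mxE.
rewrite -[RHS](mxcol0 _); apply: eq_mxcol => j; apply/matrixP => r c.
by rewrite F H mxE.
Qed.

(** The row of L = L' + 1_l states that the derivative of order L' of the
   component l of the sum of the forms vanishes; by symmetry every word of
   indices occurs. *)
Lemma Mbig_pull_jet k (w : 'cV[K]_(\sum_(h < k.+1) d)) :
  Mbig u k.+1 m *m w = 0 <->
  forall s l, (size s <= k)%N -> \sum_i pull_jet u m w i s l = 0.
Proof.
rewrite MbigP; split=> [H s l sk|H j L].
  have [L Ls] := @midx_wordP n (size s).+1 (rcons s l) (size_rcons _ _).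
  have sk' : (size s < k.+1)%N by [].
  rewrite -[RHS](H (Ordinal sk') L); apply: eq_bigr => i _; apply: eq_bigr => h _.
  by rewrite -(coefC_perm hK h oU (uU i) Ls Um).
have := size_midx_word L; case/lastP: (midx_word L) => [//|s l].
rewrite size_rcons => -[sj]; rewrite -[RHS](H s l)// sj -ltnS; exact: ltn_ord.
Qed.

Lemma jet0_van (I : finType) k (F : I -> V -> K) N : open N -> N m ->
  (forall t, holo_on N (F t)) -> jet k m F = 0 -> forall t, van k m (F t).
Proof.
move=> oN Nm FN F0 t s sk; have [L Ls] := midx_le_wordP sk.
have := congr1 (fun J : jets _ _ _ _ => J (t, L)) F0; rewrite !ffunE /=.
by rewrite (pd_word_perm hK oN (FN t) Ls Nm).
Qed.

Lemma near_coord_neq0 : exists lam : 'I_d -> 'I_n,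
  \forall x \near m, forall i, pd (lam i) (u i) x != 0.
Proof.
have /choice[lam lam0] : forall i, exists l, pd l (u i) m != 0.
  by move=> i; exact: (dform_neq0 u0 i Um).
exists lam.
have H i : \forall x \near m, pd (lam i) (u i) x != 0.
  exact: near_neq0 (holo_pd hK (lam i) oU (uU i)) Um (lam0 i).
exact: (@filter_forall _ _ _ _ _ H).
Qed.

(** Differential of a form a_i du_i. *)
Lemma Dop_scale N (a : 'I_d -> V -> K) (s : 'I_d -> V -> V) : open N -> N `<=` U ->
  (forall i, holo_on N (a i)) ->
  (forall i l x, N x -> comp1 s (i, l) x = a i x * pd l (u i) x) ->
  forall i p q x, N x ->
    Dop s (i, (p, q)) x = pd p (a i) x * pd q (u i) x - pd q (a i) x * pd p (u i) x.
Proof.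
move=> oN NU aN sE i p q x Nx; rewrite /Dop /=.
have uN : holo_on N (u i) by move=> y /NU; exact: uU.
rewrite (eq_pd p oN (sE i q) Nx) (eq_pd q oN (sE i p) Nx).
rewrite (pdM p (aN i) (holo_pd hK q oN uN) Nx) (pdM q (aN i) (holo_pd hK p oN uN) Nx).
rewrite (pd_comm hK p q oN uN Nx).
by move: (pd q (pd p (u i)) x) (a i x) => *; ring.
Qed.

(** Where it vanishes to order k - 1, the differential of a_i du_i makes a_i a
   function of u_i up to order k, whose derivatives at u_i(m) are w. *)
Lemma formal_AR_sub k (J : jets K n ('I_d * 'I_n)%type k) : formal_AR u k m J ->
  exists2 w, Mbig u k.+1 m *m w = 0 & Phi u m w = J.
Proof.
move=> [s [[sA s0] Ds] <-]; have [lam lamP] := near_coord_neq0.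
have [N [oN Nm NP]] : exists N, [/\ open N, N m & forall x, N x -> U x /\
    [/\ forall i, differentiable (s i) x, forall i, in_Ai (u i) x (s i x),
        \sum_i s i x = 0 & forall i, pd (lam i) (u i) x != 0]].
  apply: near_openP; apply: filterI; first exact: open_nbhs_nbhs.
  apply: filterS3 sA s0 lamP => x sx sx0 lx; split => // i; by have [] := sx i.
have NU : N `<=` U by move=> x /NP[].
have uN i : holo_on N (u i) by move=> y /NU; exact: uU.
have sN i l : holo_on N (comp1 s (i, l)).
  by apply: holo_entry => x /NP[_ []].
pose a i x := comp1 s (i, lam i) x * (pd (lam i) (u i) x)^-1.
have aN i : holo_on N (a i).
  apply: holoM => //; apply: holoV; first exact: holo_pd.
  by move=> x /NP[_ []].
have sE i l x : N x -> comp1 s (i, l) x = a i x * pd l (u i) x.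
  move=> Nx; have [_ [_ sAi _ l0]] := NP x Nx.
  rewrite /a mulrAC; apply: (canRL (mulfK (l0 i))).
  by rewrite mulrC (mulrC _ (pd l _ _)); exact: (in_Ai_wedge _ _ (sAi i)).
have DE := Dop_scale oN NU aN sE.
have /choice[c cP] : forall i, exists c : nat -> K,
    van k m (fun x => a i x - tay c k (u i m) (u i x)).
  move=> i; have l0 x (Nx : N x) : pd (lam i) (u i) x != 0 by have [_ [_ _ _]] := NP x Nx.
  apply: (wedge_van hK oN Nm (uN i) (aN i) l0) => k' kk' p q.
  move: Ds; rewrite kk' => Ds.
  have DN t : holo_on N (Dop s t).
    by case: t => i' [p' q']; apply: holoB; exact: holo_pd.
  exact: (van_eq oN Nm (DE i p q) (jet0_van oN Nm DN Ds (i, (p, q)))).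
pose w := \mxcol_(h < k.+1) \col_i c i h : 'cV[K]_(\sum_(h < k.+1) d).
pose g i := tay (c i) k (u i m).
have gw : has_derivatives u m w g.
  move=> i; split; first by near=> z; exact: tay_differentiable.
  by move=> h; rewrite /w mxcolK mxE /g derive1n_tay_at// -ltnS.
have sw i l t : (size t <= k)%N -> pd_word t (comp1 s (i, l)) m = pull_jet u m w i t l.
  move=> tk; rewrite -(pd_word_has_derivatives hK oU uU Um i l gw tk).
  have gN : holo_on N (fun x => g i (u i x)).
    by apply: (@holo_comp _ _ N setT) => //; exact: tay_holo.
  have pN : holo_on N (comp1 (pullback_forms u g) (i, l)).
    have -> : comp1 (pullback_forms u g) (i, l) = fun x => g i (u i x) * pd l (u i) x.
      by apply/funext => x; rewrite comp1_pullback.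
    by apply: holoM => //; exact: holo_pd.
  have dv : van k m (fun x => (a i x - g i (u i x)) * pd l (u i) x).
    by apply: (vanM hK oN Nm) => //; [exact: holoB|exact: holo_pd].
  have dE x : N x -> comp1 s (i, l) x = comp1 (pullback_forms u g) (i, l) x +
      (a i x - g i (u i x)) * pd l (u i) x.
    by move=> Nx; rewrite (sE i l x Nx) comp1_pullback; ring.
  rewrite (eq_pd_word t oN dE Nm) (pd_wordD hK t oN pN _ Nm); last first.
    by apply: holoM; [exact: holoB|exact: holo_pd].
  by rewrite dv// addr0.
exists w.
  apply/Mbig_pull_jet => t l tk.
  under eq_bigr do rewrite -sw//.
  rewrite -(@pd_word_sum _ hK _ N _ _ _ (fun i => comp1 s (i, l)))//.
  rewrite -[RHS](pd_word_cst t m); apply: (eq_pd_word t oN) => // x Nx.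
  have [_ [_ _ sx0 _]] := NP x Nx.
  have := congr1 (fun v : V => v 0 l) sx0; rewrite summxE mxE; exact.
apply/ffunP => -[[i l] L]; rewrite (PhiE hK oU uU Um) /= ffunE /=.
by rewrite sw// size_midx_le_word.
Unshelve. all: by end_near. Qed.

(** A solution w of the system gives forms g_i(u_i) du_i, each of them closed,
   whose sum vanishes to order k only. Subtracting its components on n
   independent du_i from the corresponding forms makes the sum zero, and
   changes neither the k-jets nor the (k-1)-jets of the differentials. *)
Lemma formal_AR_sup k (w : 'cV[K]_(\sum_(h < k.+1) d)) (e : 'I_n -> 'I_d) :
  (\matrix_(j, l) pd l (u (e j)) m) \in unitmx ->
  Mbig u k.+1 m *m w = 0 -> formal_AR u k m (Phi u m w).
Proof.
move=> eU /Mbig_pull_jet w0.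
pose T x : 'M[K]_n := \matrix_(j, l) pd l (u (e j)) x.
have TU (p q : 'I_n) : holo_on U (fun x => T x p q).
  by under eq_fun do rewrite mxE; exact: holo_pd.
have detm : \det (T m) != 0 by move: eU; rewrite unitmxE unitfE.
have [N [oN Nm NP]] : exists N, [/\ open N, N m & forall x, N x -> U x /\ \det (T x) != 0].
  apply: near_openP; apply: filterI; first exact: open_nbhs_nbhs.
  exact: near_neq0 (holo_det TU) Um detm.
have NU : N `<=` U by move=> x /NP[].
have uN i : holo_on N (u i) by move=> y /NU; exact: uU.
have pN i l : holo_on N (pd l (u i)) by exact: holo_pd.
pose c i := fun h => submxcol w (inord h) i 0.
pose g i := tay (c i) k (u i m).
have gE : g = taylor_poly u m w by apply/funext => i; rewrite /g /c -taylor_polyE.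
have gw : has_derivatives u m w g by rewrite gE; exact: has_derivatives_taylor.
have gN i : holo_on N (fun x => g i (u i x)).
  by apply: (@holo_comp _ _ N setT) => //; exact: tay_holo.
pose sg l x := \sum_i g i (u i x) * pd l (u i) x.
have sgN l : holo_on N (sg l) by apply: holo_sum => i _; exact: holoM.
have sgv l : van k m (sg l).
  move=> t tk; rewrite (@pd_word_sum _ hK _ N)//; last by move=> i _; exact: holoM.
  rewrite -[RHS](w0 t l tk); apply: eq_bigr => i _.
  rewrite -(pd_word_has_derivatives hK oU uU Um i l gw tk).
  by congr (pd_word _ _ _); apply/funext => x; rewrite comp1_pullback.
pose iT x := (\det (T x))^-1 *: \adj (T x).
have iTN (p q : 'I_n) : holo_on N (fun x => iT x p q).
  by apply: holo_invmx => [p' q' x /NU|x /NP[]//]; exact: TU.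
pose b j x := \sum_l sg l x * iT x l j.
have bN j : holo_on N (b j) by apply: holo_sum => l _; exact: holoM.
have bv j : van k m (b j).
  apply: (van_sum hK oN Nm) => l _; first exact: holoM.
  exact: (vanM hK oN Nm).
have bT l x : N x -> \sum_j b j x * pd l (u (e j)) x = sg l x.
  move=> /NP[_ dx].
  have iTT : iT x *m T x = 1%:M.
    by rewrite /iT -scalemxAl mul_adj_mx scale_scalar_mx mulVf.
  have := congr1 (fun v : V => v 0 l) (mulmxA (\row_l sg l x) (iT x) (T x)).
  rewrite iTT mulmx1 /= [LHS]mxE => ->; rewrite [RHS]mxE.
  apply: eq_bigr => j _; rewrite [T x j l]mxE; congr (_ * _).
  by rewrite [RHS]mxE; apply: eq_bigr => l' _; rewrite [X in _ = X * _]mxE.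
pose B i x := \sum_(j | e j == i) b j x.
have BN i : holo_on N (B i) by apply: holo_sum.
have Bv i : van k m (B i) by apply: (van_sum hK oN Nm).
pose a i x := g i (u i x) - B i x.
have aN i : holo_on N (a i) by exact: holoB.
pose s i x : V := \row_l (a i x * pd l (u i) x).
have sE i l x : comp1 s (i, l) x = a i x * pd l (u i) x by rewrite /comp1 /s mxE.
have sN i l : holo_on N (comp1 s (i, l)).
  have -> : comp1 s (i, l) = fun x => a i x * pd l (u i) x by apply/funext => x; exact: sE.
  exact: holoM.
exists s; last first.
  apply/ffunP => -[[i l] L]; rewrite (PhiE hK oU uU Um) /= ffunE /=.
  have Lk := size_midx_le_word L; set t := midx_le_word L in Lk *.
  rewrite -(pd_word_has_derivatives hK oU uU Um i l gw Lk).
  have dv : van k m (fun x => B i x * pd l (u i) x) by exact: (vanM hK oN Nm).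
  have dE x : N x -> comp1 (pullback_forms u g) (i, l) x = comp1 s (i, l) x +
      B i x * pd l (u i) x.
    by move=> Nx; rewrite sE comp1_pullback /a; ring.
  rewrite (eq_pd_word t oN dE Nm) (pd_wordD hK t oN (sN i l) _ Nm) ?dv ?addr0//.
  exact: holoM.
split; last first.
  suff H k' : k = k'.+1 -> jet k' m (Dop s) = 0.
    by case: (k) H => // k' H; exact: H.
  move=> kk.
  have DE := Dop_scale oN NU aN (fun i l x _ => sE i l x).
  apply/ffunP => -[[i [p q]] L]; rewrite !ffunE /=.
  have Lk := size_midx_le_word L; move: (midx_le_word L) Lk => t tk.
  have Bpv r : van k' m (pd r (B i)) by apply: van_pd; rewrite -kk.
  have Bph r : holo_on N (pd r (B i)) by exact: holo_pd.
  have E x : N x -> Dop s (i, (p, q)) x =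
      pd q (B i) x * pd p (u i) x - pd p (B i) x * pd q (u i) x.
    move=> Nx; rewrite (DE i p q x Nx) (pdB p (gN i) (BN i) Nx) (pdB q (gN i) (BN i) Nx).
    have gc r := @pd_comp _ _ N setT (u i) (g i) r x (uN i) (@tay_holo _ _ _ _ _) Nx I.
    rewrite (gc p) (gc q).
    move: (pd p (B i) x) (pd q (B i) x) (pd p (u i) x) (pd q (u i) x) (derive1 (g i) (u i x)) => *.
    by ring.
  rewrite (eq_pd_word t oN E Nm).
  have -> // : van k' m (fun x => pd q (B i) x * pd p (u i) x - pd p (B i) x * pd q (u i) x).
  apply: (vanB hK oN Nm); [exact: holoM|exact: holoM|exact: (vanM hK oN Nm)|exact: (vanM hK oN Nm)].
have nN : \forall x \near m, N x by exact: open_nbhs_nbhs.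
split; apply: filterS nN => x Nx.
  move=> i; split; first by apply: (@holo_row _ _ N) => // l; exact: holoM.
  have -> : s i x = a i x *: dform (u i) x by apply/rowP => l; rewrite !mxE.
  exact: in_Ai_scale.
apply/rowP => l; rewrite summxE mxE.
under eq_bigr do rewrite mxE /a mulrBl.
rewrite sumrB -/(sg l x) -(bT l x Nx); apply/eqP; rewrite subr_eq0; apply/eqP.
under [RHS]eq_bigr do rewrite mulr_suml.
rewrite (exchange_big_dep xpredT)//=; apply: eq_bigr => j _.
by rewrite (big_pred1 (e j))// => i; rewrite eq_sym.
Qed.

End FormalRelations.

(** * Kernels of matrices of constant rank *)

Section KernelFrame.
Context {K : numFieldType} {n : nat}.
Local Notation V := 'rV[K]_n.

Lemma sum_col p q (M : 'M[K]_(p, q)) (a : 'I_q -> K) :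
  \sum_j a j *: col j M = M *m \col_j a j.
Proof.
apply/matrixP => i c; rewrite summxE mxE; apply: eq_bigr => j _.
by rewrite !mxE mulrC.
Qed.

(** The kernel of a matrix of constant rank r: near m the kernel is that of r
   fixed independent rows, which are completed by constant rows to an
   invertible matrix; the last columns of its inverse are a frame. *)
Lemma kernel_frame (U : set V) p q r r' (A : V -> 'M[K]_(p, q)) m :
  q = (r + r')%N -> open U -> U m ->
  (forall i j, holo_on U (fun x => A x i j)) ->
  (forall x, U x -> \rank (A x) = r) ->
  exists W : set V, [/\ open W, W m & W `<=` U] /\
  exists e : 'I_r' -> V -> 'cV[K]_q,
    (forall j t, holo_on W (fun x => e j x t 0)) /\
    forall x, W x ->
      (forall w, A x *m w = 0 <-> exists a : 'I_r' -> K, w = \sum_j a j *: e j x) /\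
      (forall a : 'I_r' -> K, \sum_j a j *: e j x = 0 -> forall j, a j = 0).
Proof.
move=> qE oU Um AU Ar; have rm := Ar m Um.
have [f fF] : exists f : 'I_r -> 'I_p, row_free (rowsub f (A m)).
  by rewrite -rm; exists (maxrankfun (A m)); exact: maxrowsub_free.
set B := rowsub f (A m) in fF.
have rB : \rank B = r by apply/eqP.
have [E EF] : exists E : 'M[K]_(r', q), row_full (col_mx B E).
  have -> : r' = \rank (B^C)%MS by rewrite mxrank_compl rB qE addKn.
  exists (row_base (B^C)%MS); rewrite -sub1mx -addsmxE.
  have := addsmx_compl_full B; rewrite -sub1mx => /submx_trans; apply.
  by apply: addsmxS => //; rewrite eq_row_base.
subst q.
pose T x : 'M[K]_(r + r') := col_mx (rowsub f (A x)) E.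
have TU i j : holo_on U (fun x => T x i j).
  rewrite /T; case: (split_ordP i) => i' ->.
    by under eq_fun do rewrite col_mxEu mxE; exact: AU.
  by under eq_fun do rewrite col_mxEd; exact: holo_cst.
have detm : \det (T m) != 0 by move: EF; rewrite row_full_unit unitmxE unitfE.
have [W [oW Wm WP]] : exists W, [/\ open W, W m & forall x, W x -> U x /\ \det (T x) != 0].
  apply: near_openP; apply: filterI; first exact: open_nbhs_nbhs.
  exact: near_neq0 (holo_det TU) Um detm.
exists W; split; first by split => // x /WP[].
pose iT x := (\det (T x))^-1 *: \adj (T x).
exists (fun j x => col j (rsubmx (iT x))); split.
  move=> j t; have -> : (fun x => col j (rsubmx (iT x)) t 0) = fun x => iT x t (rshift r j).
    by apply/funext => x; rewrite [LHS]mxE [LHS]mxE.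
  exact: (holo_invmx (fun i j x h => TU i j x (WP x h).1) (fun x h => (WP x h).2)).
move=> x Wx; have [Ux dx] := WP x Wx.
have iTT : iT x *m T x = 1%:M.
  by rewrite /iT -scalemxAl mul_adj_mx scale_scalar_mx mulVf.
have TiT : T x *m iT x = 1%:M.
  by rewrite /iT -scalemxAr mul_mx_adj scale_scalar_mx mulVf.
have eE (a : 'I_r' -> K) : \sum_j a j *: col j (rsubmx (iT x)) = iT x *m col_mx 0 (\col_j a j).
  by rewrite sum_col -[iT x in RHS]hsubmxK mul_row_col mulmx0 add0r.
have TE (a : 'I_r' -> K) : T x *m \sum_j a j *: col j (rsubmx (iT x)) = col_mx 0 (\col_j a j).
  by rewrite eE mulmxA TiT mul1mx.
have rF : row_free (rowsub f (A x)).
  apply/row_freeP; exists (lsubmx (iT x)).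
  have := TiT; rewrite -{1}[iT x]hsubmxK /T mul_col_row scalar_mx_block.
  by move=> /eq_block_mx[].
have subA : (A x <= rowsub f (A x))%MS.
  have le : (rowsub f (A x) <= A x)%MS.
    apply/row_subP => i; rewrite row_rowsub; exact: row_sub.
  by rewrite -(mxrank_leqif_sup le) (Ar x Ux); apply/eqP; exact/eqP.
have [D AE] := submxP subA.
split=> [w|a a0].
  split=> [Aw|[a ->]]; last first.
    rewrite AE -mulmxA; have := TE a; rewrite /T mul_col_mx => /eq_col_mx[-> _].
    by rewrite mulmx0.
  have Bw : rowsub f (A x) *m w = 0.
    by rewrite -[A x]mul1mx -mul_rowsub_mx -mulmxA Aw mulmx0.
  exists (fun j => (E *m w) j 0); rewrite eE.
  rewrite -[LHS]mul1mx -iTT -mulmxA; congr (_ *m _).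
  rewrite /T mul_col_mx Bw; congr col_mx; apply/colP => j; by rewrite [RHS]mxE.
move=> j; have := TE a; rewrite a0 mulmx0 => /esym/eqP.
rewrite col_mx_eq0 => /andP[_ /eqP] /colP/(_ j).
by rewrite !mxE.
Qed.

End KernelFrame.

(** * Bundles of formal abelian relations and their prolongation *)

Section Consequences.
Context {K : numFieldType} (hK : smooth_field K) {n d : nat}.
Local Notation V := 'rV[K]_n.
Variables (U : set V) (u : 'I_d -> V -> K).
Hypotheses (oU : open U) (uU : forall i, holo_on U (u i)).
Hypothesis u0 : forall i x, U x -> dform (u i) x != 0.

Lemma formal_AR_eq (hG : weak_general_position U u) k m : U m ->
  [set Phi u m w | w in [set w | Mbig u k.+1 m *m w = 0]] = formal_AR u k m.
Proof.
move=> Um; apply/seteqP; split=> [_ [w /= w0 <-]|J /(formal_AR_sub hK oU uU u0 Um)[w w0 <-]].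
  have [S nS gS] := hG m Um; have [e eU] := general_position_unit nS gS.
  exact: (formal_AR_sup hK oU uU Um eU w0).
by exists w.
Qed.

Lemma Phi_J_sumAi k m (w : 'cV[K]_(\sum_(h < k.+1) d)) : U m -> J_sumAi u k m (Phi u m w).
Proof.
move=> Um; exists (pullback_forms u (taylor_poly u m w)) => //.
have nU : \forall x \near m, U x by exact: open_nbhs_nbhs.
apply: filterS nU => x Ux i; split; last exact: in_Ai_scale.
have -> : pullback_forms u (taylor_poly u m w) i =
    fun x => \row_l (taylor_poly u m w i (u i x) * pd l (u i) x).
  by apply/funext => y; apply/rowP => l; rewrite !mxE.
apply: (@holo_row _ _ U) => // l; apply: holoM; last exact: holo_pd.
by rewrite taylor_polyE; apply: (@holo_comp _ _ U setT) => //; exact: tay_holo.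
Qed.

Lemma Mbig_entry_holo k i j : holo_on U (fun x => Mbig u k x i j).
Proof.
by under eq_fun do rewrite !mxE; exact: holo_coefC.
Qed.

Lemma formal_AR_bundle (hG : weak_general_position U u) k r :
  (forall x, U x -> \rank (Mbig u k.+1 x) = r) ->
  holo_vector_bundle U (formal_AR u k) (k.+1 * d - r).
Proof.
move=> rU m Um.
have qE : (\sum_(h < k.+1) d = r + (k.+1 * d - r))%N.
  rewrite sum_nat_const card_ord subnKC// -(rU m Um) -[X in (_ <= X * _)%N](card_ord k.+1).
  by rewrite -sum_nat_const rank_leq_col.
have [W [[oW Wm WU] [e [eW eP]]]] := kernel_frame qE oU Um (@Mbig_entry_holo k.+1) rU.
exists W; first by split.
exists (fun j x => [ffun t => pull_jet u x (e j x) t.1.1 (midx_le_word t.2) t.1.2]).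
split=> [j t|x Wx].
  under eq_fun do rewrite ffunE; apply: holo_sum => h _; apply: holoM.
    by move=> x /WU; exact: holo_coefC.
  by under eq_fun do rewrite mxE; exact: eW.
have Ux := WU _ Wx.
have [eK eI] := eP x Wx.
pose PhiL : {linear 'cV[K]_(\sum_(h < k.+1) d) -> jets K n ('I_d * 'I_n)%type k} :=
  HB.pack (Phi u x) (GRing.isLinear.Build _ _ _ _ (Phi u x) (Phi_linear hK oU uU Ux (k := k))).
have SE (a : 'I_(k.+1 * d - r) -> K) :
    \sum_j a j *: [ffun t => pull_jet u x (e j x) t.1.1 (midx_le_word t.2) t.1.2] =
    Phi u x (\sum_j a j *: e j x).
  rewrite -[RHS]/(PhiL _) linear_sum; apply: eq_bigr => j _; rewrite linearZ /=; congr (_ *: _).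
  by apply/ffunP => t; rewrite ffunE (PhiE hK oU uU Ux).
split.
  rewrite -(formal_AR_eq hG k Ux); apply/seteqP; split=> [_ [w /= /eK[a ->] <-]|_ [a _ <-]].
    by exists a => //; rewrite SE.
  by exists (\sum_j a j *: e j x); [apply/eK; exists a|rewrite SE].
move=> a; rewrite SE => a0; apply: eI; apply: (Phi_inj hK oU uU u0 Ux).
by rewrite a0 -[RHS]/(PhiL _) linear0.
Qed.

Lemma Mblock0 j h x : (j <= h)%N -> Mblock u j h x = 0.
Proof.
by move=> jh; apply/matrixP => r i; rewrite !mxE coefC_big// size_midx_word.
Qed.

(** The blocks with h >= j are zero, in the numbering of the rows from 1, so the
   matrix is block triangular with diagonal blocks P_j; a vector killing it is
   zero block by block, starting from the last one. *)
Lemma Mbig_row_free k x : 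
  (forall j, (j < k)%N -> \rank (Pmx u j.+1 x) = #|midx n j.+1|) -> row_free (Mbig u k x).
Proof.
move=> Pr; apply: inj_row_free => v; rewrite -[v]submxrowK mul_mxrow_mxblock => v0.
have {v0} H (h : 'I_k) : \sum_(j < k) submxrow v j *m Mblock u j.+1 h x = 0.
  by have := congr1 (fun M => submxrow M h) v0; rewrite mxrowK submxrow0.
suff vj q : forall j : 'I_k, (k - j <= q)%N -> submxrow v j = 0.
  by rewrite -[RHS](mxrow0 _); apply: eq_mxrow => j; exact: (vj (k - j)%N).
elim: q => [|q IH] j; first by rewrite leqn0 subn_eq0 leqNgt ltn_ord.
move=> kj; have := H j; rewrite (bigD1 j)//= big1 ?addr0 => [/eqP|j' j'j].
  have PF : row_free (Pmx u j.+1 x) by apply/eqP; exact: Pr.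
  by rewrite (mulmx_free_eq0 _ PF) => /eqP.
have [jj'|jj'|/val_inj jj'] := ltngtP j j'.
- by rewrite IH ?mul0mx// -ltnS (leq_trans _ kj)// ltn_sub2l// ltn_ord.
- by rewrite Mblock0 ?mulmx0.
- by move: j'j; rewrite jj' eqxx.
Qed.

Lemma leq_cnum j j' : (j <= j')%N -> (cnum n j <= cnum n j')%N.
Proof.
move=> jj'; rewrite /cnum -(bin_sub (leq_addl (n - 1) j)) -(bin_sub (leq_addl (n - 1) j')) !addnK.
by apply: leq_bin2l; rewrite leq_add2l.
Qed.

(** All j in play satisfy c(n, j) < d, so that ordinariness means full row rank
   of P_j. *)
Lemma ordinary_rank (n0 : (0 < n)%N) h0 k : ordinary U u ->
  (cnum n h0.-1 < d)%N -> (k + 2 <= h0)%N ->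
  exists r : nat, forall x, U x -> \rank (Mbig u k.+1 x) = r.
Proof.
move=> oW hd kh; exists (\sum_(j < k.+1) #|midx n j.+1|)%N => x Ux.
apply/eqP; apply: Mbig_row_free => j jk; rewrite oW// card_midx//.
apply/minn_idPr; rewrite ltnW// (leq_ltn_trans _ hd)// leq_cnum//.
by apply: leq_trans jk _; rewrite -ltnS (leq_trans _ (leqSpred h0))// -addn2.
Qed.

Section Prolongation.
Variable m : V.
Hypothesis Um : U m.

Lemma Mbig_mxcol k (f : 'I_k -> 'cV[K]_d) :
  Mbig u k m *m \mxcol_h f h = 0 <->
  forall j : 'I_k, \sum_(h < k) Mblock u j.+1 h m *m f h = 0.
Proof.
rewrite mul_mxblock_mxrow; split=> [H j|H].
  by have := congr1 (fun M => submxcol M j) H; rewrite mxcolK submxcol0.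
by rewrite -[RHS](mxcol0 _); apply: eq_mxcol.
Qed.

Lemma Qmx_mxcol k (f : 'I_k.+1 -> 'cV[K]_d) :
  Qmx u k.+1 m *m \mxcol_h f h = \sum_(h < k.+1) Mblock u k.+2 h m *m f h.
Proof. exact: mul_mxrow_mxcol. Qed.

Lemma fam_rcons_lift k (f : 'I_k -> 'cV[K]_d) g h :
  fam_rcons f g (widen_ord (leqnSn k) h) = f h.
Proof.
rewrite /fam_rcons (_ : widen_ord _ _ = lift ord_max h); first by rewrite liftK.
by apply/val_inj; rewrite /= /bump leqNgt ltn_ord.
Qed.

Lemma fam_rcons_max k (f : 'I_k -> 'cV[K]_d) g : fam_rcons f g ord_max = g.
Proof. by rewrite /fam_rcons unlift_none. Qed.

Lemma fam_rcons_eta k (F : 'I_k.+1 -> 'cV[K]_d) :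
  fam_rcons (fun h => F (widen_ord (leqnSn k) h)) (F ord_max) = F.
Proof.
apply/funext => h; have [hk|hk] := ltnP h k.
  by rewrite (_ : h = widen_ord (leqnSn k) (Ordinal hk)) ?fam_rcons_lift//; apply/val_inj.
rewrite (_ : h = ord_max) ?fam_rcons_max//; apply/val_inj/eqP.
by rewrite eqn_leq hk -ltnS ltn_ord.
Qed.

(** The last block column is zero except for P_(k+2) in the last block row. *)
Lemma Mbig_fam_rcons k (f : 'I_k.+1 -> 'cV[K]_d) g :
  Mbig u k.+2 m *m \mxcol_h fam_rcons f g h = 0 <->
  Mbig u k.+1 m *m \mxcol_h f h = 0 /\
  Pmx u k.+2 m *m g = - (Qmx u k.+1 m *m \mxcol_h f h).
Proof.
have E j : \sum_(h < k.+2) Mblock u j.+1 h m *m fam_rcons f g h =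
    \sum_(h < k.+1) Mblock u j.+1 h m *m f h + Mblock u j.+1 k.+1 m *m g.
  rewrite big_ord_recr /= fam_rcons_max; congr (_ + _).
  by apply: eq_bigr => h _; rewrite fam_rcons_lift.
rewrite !Mbig_mxcol Qmx_mxcol; split=> [H|[H1 H2] j].
  split=> [j|].
    have := H (widen_ord (leqnSn _) j); rewrite E /=.
    by rewrite [Mblock _ _ k.+1 _]Mblock0 ?mul0mx ?addr0// ltn_ord.
  by have := H ord_max; rewrite E /= addrC => /eqP; rewrite addr_eq0 => /eqP.
rewrite E; have [jk|jk] := ltnP j k.+1.
  by rewrite [Mblock _ _ k.+1 _]Mblock0// mul0mx addr0 (H1 (Ordinal jk)).
have -> : j = ord_max by apply/val_inj/eqP; rewrite eqn_leq jk -ltnS ltn_ord.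
by rewrite /= [Mblock _ _ k.+1 _ *m g]H2 subrr.
Qed.

Lemma jet_trunc_Phi k (f : 'I_k.+1 -> 'cV[K]_d) g :
  jet_trunc (Phi u m (\mxcol_h fam_rcons f g h)) = Phi u m (\mxcol_h f h).
Proof.
apply/ffunP => -[[i l] L]; rewrite [LHS]ffunE !(PhiE hK oU uU Um) /= midx_le_word_widen.
rewrite /pull_jet big_ord_recr /= [X in _ + X]mulrC coefC_big; last first.
  by rewrite size_rcons ltnS size_midx_le_word.
rewrite mulr0 addr0; apply: eq_bigr => h _; rewrite !mxcolK.
by rewrite fam_rcons_lift.
Qed.

Lemma formal_AR_prolongation (hG : weak_general_position U u) k a
    (f : 'I_k.+1 -> 'cV[K]_d) :
  formal_AR u k m a -> a = Phi u m (\mxcol_h f h) ->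
  [set b | formal_AR u k.+1 m b /\ jet_trunc b = a] =
  [set Phi u m (\mxcol_h fam_rcons f g h) |
     g in [set g : 'cV[K]_d |
             Pmx u k.+2 m *m g = - (Qmx u k.+1 m *m \mxcol_h f h)]].
Proof.
move=> aR aE; have f0 : Mbig u k.+1 m *m \mxcol_h f h = 0.
  move: aR; rewrite -(formal_AR_eq hG k Um) => -[w /= w0 wa].
  by rewrite (_ : \mxcol_h f h = w)//; apply: (Phi_inj hK oU uU u0 Um); rewrite wa.
apply/seteqP; split=> [b [/=]|_ [g /= gE <-]].
  rewrite -(formal_AR_eq hG k.+1 Um) => -[w /= w0 <-] bE.
  pose F h := submxcol w h; have wE : w = \mxcol_h fam_rcons
      (fun h => F (widen_ord (leqnSn _) h)) (F ord_max) h.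
    by rewrite fam_rcons_eta submxcolK.
  have FE : (fun h => F (widen_ord (leqnSn _) h)) = f.
    apply/funext; apply/(eq_mxcolP _ _); apply: (Phi_inj hK oU uU u0 Um).
    by rewrite -aE -bE [in RHS]wE jet_trunc_Phi.
  rewrite FE in wE; exists (F ord_max); last by rewrite -wE.
  by move: w0; rewrite wE => /Mbig_fam_rcons[_].
split; last by rewrite aE jet_trunc_Phi.
rewrite -(formal_AR_eq hG k.+1 Um); exists (\mxcol_h fam_rcons f g h) => //=.
by apply/Mbig_fam_rcons; split.
Qed.

End Prolongation.

End Consequences.

Theorem mainTheorem1 (R : realType) (n d : nat)
    (U : set 'rV[R[i]]_n) (u : 'I_d -> 'rV[R[i]]_n -> R[i])
    (hn : (2 <= n)%N) (hd : (n < d)%N)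
    (hW : is_web U u) (hG : weak_general_position U u) :
  (* (i) *)
  (forall k : nat,
     (forall m, U m ->
        [/\ (* Phi_{k,m} does not depend on the choice of the g_i *)
            (forall (w : 'cV[R[i]]_(\sum_(h < k.+1) d))
                (g : 'I_d -> R[i] -> R[i]),
               has_derivatives u m w g ->
               jet k m (comp1 (pullback_forms u g)) = Phi u m w),
            (* Phi_{k,m} is an injective linear map into the sum of the
               J^k_m A_i *)
            linear (@Phi _ n d u k m),
            injective (@Phi _ n d u k m),
            (forall w, J_sumAi u k m (Phi u m w)) &
            [set Phi u m w | w in [set w | Mbig u k.+1 m *m w = 0]] =
              formal_AR u k m]) /\
     (forall r : nat, (forall x, U x -> \rank (Mbig u k.+1 x) = r) ->
        holo_vector_bundle U (formal_AR u k) (k.+1 * d - r))) /\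
  (ordinary U u -> forall h0 : nat, (cnum n h0.-1 < d <= cnum n h0)%N ->
     forall k : nat, (k + 2 <= h0)%N ->
     exists r : nat, forall x, U x -> \rank (Mbig u k.+1 x) = r) /\
  (* (ii), for the passage from R_k to R_{k+1}, k >= 0 *)
  (forall (k : nat) m, U m ->
     forall (a : jets R[i] n ('I_d * 'I_n)%type k)
            (f : 'I_k.+1 -> 'cV[R[i]]_d),
     formal_AR u k m a -> a = Phi u m (\mxcol_h f h) ->
     [set b | formal_AR u k.+1 m b /\ jet_trunc b = a] =
       [set Phi u m (\mxcol_h fam_rcons f g h) |
          g in [set g : 'cV[R[i]]_d |
                  Pmx u k.+2 m *m g = - (Qmx u k.+1 m *m \mxcol_h f h)]] /\
     - (Qmx u k.+1 m *m \mxcol_h f h) =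
       - \sum_(h < k.+1) Mblock u k.+2 h m *m f h).
Proof.
have hK := @complex_smooth R; case: hW => oU uU u0 _.
split; last split.
- move=> k; split; last by move=> r; exact: (formal_AR_bundle hK oU uU u0 hG).
  move=> m Um; split.
  + by move=> w g; exact: (jet_has_derivatives hK oU uU Um).
  + exact: (Phi_linear hK oU uU Um).
  + exact: (Phi_inj hK oU uU u0 Um).
  + by move=> w; exact: (Phi_J_sumAi hK oU uU w Um).
  + exact: (formal_AR_eq hK oU uU u0 hG k Um).
- move=> oW h0 /andP[hd0 _] k kh; exact: (ordinary_rank (ltnW hn) oW hd0 kh).
- move=> k m Um a f aR aE; split; last by rewrite Qmx_mxcol.
  exact: (formal_AR_prolongation hK oU uU u0 Um hG aR aE).
Qed.
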